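(* Let $\boldsymbol B,\boldsymbol E\in C^2(\mathbb{R}^3;\mathbb{R}^3)$, let $T>0$ be fixed, let $U^0=(\boldsymbol x_0,t_0,\boldsymbol v_0,w_0)^T\in X$, and let $X$, $L$, $F$ be as defined in the context. Let $U:[0,T]\to X$ be the exact solution of $$U'(\tau)=LU(\tau)+F(U(\tau)),\qquad U(0)=U^0 .$$ For a time step $0<h\le 1$ put $\tau_n=nh$ and let $U^n$ be the numerical solution given by the symmetric exponential integrator $$U^1=e^{hL}U^0+h\,e^{hL}F(U^0),\qquad U^{n+1}=e^{2hL}U^{n-1}+2h\,e^{hL}F(U^n)\quad(n\ge 1).$$ Then there is a constant $C$, independent of $n$ and $h$ but depending on $T$, such that for every $0<h\le 1$ $$\|U(\tau_n)-U^n\|\le C h^2,\qquad 0\le n\le T/h .$$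
   Context: Write $\boldsymbol B=(B_1,B_2,B_3)$ (magnetic field), $\boldsymbol E=(E_1,E_2,E_3)$ (electric field), and let $i$ be the imaginary unit. The state space is $$X=\{(\boldsymbol x,t,\boldsymbol v,w)^T:\ \boldsymbol x,\boldsymbol v\in\mathbb{R}^3,\ t,w\in i\mathbb{R}\}\subset\mathbb{C}^8,$$ a real vector space of dimension 8 (the ''time'' variables $t$ and $w$ are purely imaginary), and $\|\cdot\|$ is the Euclidean norm on $\mathbb{C}^8$. For $\boldsymbol x\in\mathbb{R}^3$ define (fields evaluated at $\boldsymbol x$) $$\widehat B(\boldsymbol x)=\begin{pmatrix}0&B_3&-B_2&0\\ -B_3&0&B_1&0\\ B_2&-B_1&0&0\\ 0&0&0&0\end{pmatrix},\qquad \widehat E(\boldsymbol x)=\begin{pmatrix}0&0&0&-iE_1\\ 0&0&0&-iE_2\\ 0&0&0&-iE_3\\ iE_1&iE_2&iE_3&0\end{pmatrix}.$$ With $\boldsymbol x_0$ the initial position (the first component of $U^0$), set $$G(\boldsymbol x)=\widehat B(\boldsymbol x)-\widehat B(\boldsymbol x_0)+\widehat E(\boldsymbol x),\qquad L=\begin{pmatrix}0&I_4\\ 0&\widehat B(\boldsymbol x_0)\end{pmatrix}\in\mathbb{R}^{8\times 8},$$ and for $U=(\boldsymbol x,t,\boldsymbol v,w)^T\in X$, with $\boldsymbol u=(\boldsymbol v,w)^T$, set $$F(U)=\begin{pmatrix}0\\ G(\boldsymbol x)\boldsymbol u\end{pmatrix}\in X,$$ where the upper $0$ is the zero vector with 4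 components. The system $U'=LU+F(U)$ is the four-dimensional spacetime form, in proper time $\tau$, of the relativistic charged-particle equations: $\dot{\boldsymbol x}=\boldsymbol v$, $\dot t=w$, $\dot{\boldsymbol v}=-iw\boldsymbol E(\boldsymbol x)+\boldsymbol v\times\boldsymbol B(\boldsymbol x)$, $\dot w=i\boldsymbol E(\boldsymbol x)\cdot\boldsymbol v$. The constant $C$ may depend on $T$, on the fields $\boldsymbol B,\boldsymbol E$, and on the (fixed) initial value and exact solution. *)

(* Defs.v *)
From HB Require Import structures.
From mathcomp Require Import all_boot all_order all_algebra.
From mathcomp Require Import all_classical all_reals all_analysis.
From mathcomp Require Import complex.

Set Implicit Arguments.
Unset Strict Implicit.
Unset Printing Implicit Defensive.

Import Order.TTheory GRing.Theory Num.Theory.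
Import numFieldNormedType.Exports.

Local Open Scope classical_set_scope.
Local Open Scope ring_scope.
Local Open Scope complex_scope.

(* The usual topology of the complex numbers, given by the modulus: it is
   inherited from numClosedFieldType but not inferred on the bare type R[i]. *)
#[non_forgetful_inheritance]
HB.instance Definition _ (R : rcfType) :=
  NormedModule.copy R[i] (R[i]^o : normedModType R[i]).

(* [cdiff k f]: f is of class C^k. In finite dimension the differential Df is
   C^k as soon as x |-> Df(x) v is C^k for each fixed v. *)
Fixpoint cdiff (R : realType) (m n k : nat)
    (f : 'cV[R]_m.+1 -> 'cV[R]_n.+1) : Prop :=
  if k is k'.+1 then
    (forall x, differentiable f x) /\ (forall v, cdiff k' (fun x => 'd f x v))
  else continuous f.

Definition expm (R : realType) (n : nat) (A : 'M[R]_n.+1) : 'M[R]_n.+1 :=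
  limn (series (fun k : nat => (k`!%:R : R)^-1 *: A ^+ k)).

Definition mx4 (K : nzRingType) (rows : seq (seq K)) : 'M[K]_4 :=
  \matrix_(i, j) (nth [::] rows i)`_j.

Section System.
Variables (R : realType) (B E : 'cV[R]_3 -> 'cV[R]_3).

Definition complex_mx (m n : nat) (A : 'M[R]_(m, n)) : 'M[R[i]]_(m, n) :=
  map_mx (real_complex R) A.

(* Components are numbered from 0: U = (x, t, v, w) has t at index 3 and w at
   index 7; these two are purely imaginary and the other six are real. *)
Definition state_space : set 'cV[R[i]]_8 :=
  [set U | forall k : 'I_8, if (k %% 4 == 3)%N then complex.Re (U k 0) = 0
                            else complex.Im (U k 0) = 0].

Definition euclid_norm (U : 'cV[R[i]]_8) : R :=
  Num.sqrt (\sum_k ComplexField.Normc.normc (U k 0) ^+ 2).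

(* The real part is the identity on the first three components of an element
   of the state space. *)
Definition position (U : 'cV[R[i]]_8) : 'cV[R]_3 :=
  \col_(k < 3) complex.Re (U (inord k) 0).

Definition four_velocity (U : 'cV[R[i]]_8) : 'cV[R[i]]_4 :=
  dsubmx (U : 'cV[R[i]]_(4 + 4)).

Definition Bhat (x : 'cV[R]_3) : 'M[R]_4 :=
  let b (k : 'I_3) := B x k 0 in
  mx4 [:: [:: 0;     b 2;   - b 1; 0];
          [:: - b 2; 0;     b 0;   0];
          [:: b 1;   - b 0; 0;     0];
          [:: 0;     0;     0;     0]].

Definition Ehat (x : 'cV[R]_3) : 'M[R[i]]_4 :=
  let e (k : 'I_3) := E x k 0 in
  mx4 [:: [:: 0;        0;        0;        0 -i* e 0];
          [:: 0;        0;        0;        0 -i* e 1];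
          [:: 0;        0;        0;        0 -i* e 2];
          [:: 0 +i* e 0; 0 +i* e 1; 0 +i* e 2; 0]].

Section InitialPosition.
Variable x0 : 'cV[R]_3.

Definition Gmx (x : 'cV[R]_3) : 'M[R[i]]_4 :=
  complex_mx (Bhat x - Bhat x0) + Ehat x.

Definition Lmx : 'M[R]_8 :=
  (block_mx 0 1%:M 0 (Bhat x0) : 'M[R]_(4 + 4)).

Definition Ffun (U : 'cV[R[i]]_8) : 'cV[R[i]]_8 :=
  (col_mx 0 (Gmx (position U) *m four_velocity U) : 'cV[R[i]]_(4 + 4)).

End InitialPosition.

(* The derivative at tau is the limit of the difference quotient within
   [0, T], hence one-sided at the end points. *)
Definition is_exact_solution (T : R) (U0 : 'cV[R[i]]_8)
    (U : R -> 'cV[R[i]]_8) : Prop :=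
  let x0 := position U0 in
  U 0 = U0 /\
  forall tau, 0 <= tau <= T ->
    state_space (U tau) /\
    ((s - tau)^-1%:C *: (U s - U tau)) @[s --> within `[0, T] tau^'] -->
      complex_mx (Lmx x0) *m U tau + Ffun x0 (U tau).

Fixpoint num_solution (U0 : 'cV[R[i]]_8) (h : R) (n : nat) : 'cV[R[i]]_8 :=
  let x0 := position U0 in
  let expL (s : R) := complex_mx (expm (s *: Lmx x0)) in
  match n with
  | 0%N => U0
  | n1.+1 =>
    match n1 with
    | 0%N => expL h *m U0 + h%:C *: (expL h *m Ffun x0 U0)
    | n2.+1 => expL (2 * h) *m num_solution U0 h n2
               + (2 * h)%:C *: (expL h *m Ffun x0 (num_solution U0 h n1))
    end
  end.

End System.

(* Main.v *)
From HB Require Import structures.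
Require Import Defs.
From mathcomp Require Import all_boot all_order all_algebra.
From mathcomp Require Import all_classical all_reals all_analysis.
From mathcomp Require Import complex.
From mathcomp Require Import ring lra.
Import Order.TTheory GRing.Theory Num.Theory.
Import numFieldNormedType.Exports.

(** In the rotating variable V(tau) = e^(-tau L) U(tau) the linear part
    disappears: V' = f(tau, V) with f(tau, b) = e^(-tau L) F(e^(tau L) b), and
    W_n = e^(-nh L) U^n satisfies
      W_1 = W_0 + h f(0, W_0),   W_(n+1) = W_(n-1) + 2h f(nh, W_n),
    which is the leapfrog (explicit midpoint) rule started by one Euler step.
    The theorem is the classical statement that this rule has order two: the
    Euler step makes a defect O(h^2), but only once, each leapfrog step makes a
    defect O(h^3), and the recursion is stable.

    Consistency. The midpoint rule has defect O(h^3) as soon as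
    g(tau) = f(tau, V(tau)) has first-order expansions with a quadratic
    remainder, uniformly on [0,T] ([midpoint_rule]). The class [taylor_on] of
    functions with such expansions is stable under sums, products and
    composition; it contains the C^2 maps on every ball ([cdiff2_taylor]) and
    the solutions of equations with a locally Lipschitz right-hand side
    ([solution_taylor]), hence g.

    Stability. The errors satisfy e_(n+2) <= e_n + 2hK e_(n+1) + c h^3, so they
    are dominated by c h^2 (1 + (2K+1)h)^n ([leapfrog_stability]). As F is only
    locally Lipschitz, K is available only while the errors stay below 1; the
    bound itself guarantees this when c h^2 e^((2K+1)T) <= 1. For the other
    values of h, the number n <= T/h of steps is bounded and each of these
    finitely many iterates is bounded uniformly in h, so the error is bounded
    by a constant, that is, by a constant times h^2.

    Writing the imaginary components as i times real ones identifies the state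
    space X with R^8. Neither F nor e^(sL) mixes the two kinds of components,
    so the whole scheme lives in R^8 ([num_solution_embed]); there the
    convergence is proved for an arbitrary L and F
    ([exp_leapfrog_convergence]). *)

Set Implicit Arguments.
Unset Strict Implicit.
Unset Printing Implicit Defensive.

Local Open Scope classical_set_scope.
Local Open Scope ring_scope.

(** * Functions with quadratic Taylor remainders *)

Lemma choice2 (I T : Type) (P Q : I -> T -> Prop) :
  (forall i, exists2 k, P i k & Q i k) ->
  {K : I -> T & forall i, P i (K i) /\ Q i (K i)}.
Proof.
move=> H; apply: (choice (P := fun i k => P i k /\ Q i k)) => i.
by have [k] := H i; exists k.
Qed.

Section TaylorClass.
Variable R : realType.

(** First-order expansions on [A] with a quadratic remainder, the constant being
    uniform on [A]. This is all that second-order consistency needs from C^2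
    regularity. It makes sense at the end points of an interval, and it passes
    through products and compositions by algebra alone. *)
Definition taylor_on (X Y : normedModType R) (A : set X) (f : X -> Y) : Prop :=
  exists K : R, exists D : X -> X -> Y, 0 <= K /\
    forall x, A x -> [/\ linear (D x),
      forall v, `|D x v| <= K * `|v| &
      forall y, A y -> `|f y - f x - D x (y - x)| <= K * `|y - x| ^+ 2].

Definition norm_ball (X : normedModType R) (r : R) : set X :=
  [set x | `|x| <= r].

Definition lipschitz_on (X Y : normedModType R) (A : set X) (f : X -> Y) :
    Prop :=
  exists2 K : R, 0 <= K & forall x y, A x -> A y ->
    `|f y - f x| <= K * `|y - x|.

Definition bounded_on (X Y : normedModType R) (A : set X) (f : X -> Y) : Prop :=
  exists2 K : R, 0 <= K & forall x, A x -> `|f x| <= K.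

Lemma itv_ball (T : R) : `[0, T]%classic `<=` norm_ball T.
Proof.
by move=> t; rewrite /= in_itv /norm_ball /= => /andP[t0 tT]; rewrite ger0_norm.
Qed.

(** On a bounded set the quadratic remainder is also a linear one. *)
Lemma taylor_lipschitz (X Y : normedModType R) (A : set X) (f : X -> Y)
    (r : R) :
  A `<=` norm_ball r -> taylor_on A f -> lipschitz_on A f.
Proof.
move=> Ar [K [D [K0 HD]]]; exists (K + K * (2 * `|r|)).
  by rewrite addr_ge0 // !mulr_ge0.
move=> x y Ax Ay; have [_ D1 /(_ _ Ay) D2] := HD _ Ax.
have xr : `|x| <= `|r| by apply: le_trans (Ar _ Ax) (ler_norm _).
have yr : `|y| <= `|r| by apply: le_trans (Ar _ Ay) (ler_norm _).
have d : `|y - x| <= 2 * `|r|.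
  by rewrite (le_trans (ler_normB _ _)) //; lra.
rewrite -[f y - f x](subrK (D x (y - x))) (le_trans (ler_normD _ _)) //.
rewrite addrC mulrDl lerD // (le_trans D2) // expr2 -mulrA ler_wpM2l //.
by rewrite ler_wpM2r.
Qed.

Lemma lipschitz_bounded (X Y : normedModType R) (A : set X) (f : X -> Y)
    (r : R) :
  A `<=` norm_ball r -> lipschitz_on A f -> bounded_on A f.
Proof.
move=> Ar [K K0 HK]; have [[a Aa]|nA] := pselect (exists a, A a); last first.
  by exists 0 => // x Ax; case: nA; exists x.
exists (`|f a| + K * (2 * `|r|)); first by rewrite addr_ge0 // !mulr_ge0.
move=> x Ax; rewrite -[f x](subrK (f a)) (le_trans (ler_normD _ _)) // addrC.
rewrite lerD2l (le_trans (HK _ _ Aa Ax)) // ler_wpM2l //.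
have xr : `|x| <= `|r| by apply: le_trans (Ar _ Ax) (ler_norm _).
have ar : `|a| <= `|r| by apply: le_trans (Ar _ Aa) (ler_norm _).
by rewrite (le_trans (ler_normB _ _)) //; lra.
Qed.

Lemma lipschitzD (X Y : normedModType R) (D : set X) (f g : X -> Y) :
  lipschitz_on D f -> lipschitz_on D g -> lipschitz_on D (fun v => f v + g v).
Proof.
move=> [K K0 HK] [K' K'0 HK']; exists (K + K'); first exact: addr_ge0.
move=> x y Dx Dy; rewrite opprD addrACA mulrDl.
apply: le_trans (ler_normD _ _) _.
by apply: lerD; [exact: HK|exact: HK'].
Qed.

Lemma taylor_cst (X Y : normedModType R) (A : set X) (c : Y) :
  taylor_on A (fun=> c).
Proof.
exists 0, (fun _ _ => 0); split=> // x Ax; split=> [k v w|v|y Ay].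
- by rewrite scaler0 addr0.
- by rewrite normr0 mul0r.
- by rewrite subrr subr0 normr0 mul0r.
Qed.

(** A linear map is its own expansion, with zero remainder. *)
Lemma taylor_linear (X Y : normedModType R) (A : set X) (f : X -> Y) (K : R) :
  linear f -> (forall x, `|f x| <= K * `|x|) -> taylor_on A f.
Proof.
move=> fL fK; have fB x y : f (x - y) = f x - f y.
  by rewrite addrC -scaleN1r fL scaleN1r addrC.
exists `|K|, (fun _ => f); split=> // x Ax; split=> // [v|y Ay].
  by rewrite (le_trans (fK _)) // ler_wpM2r // ler_norm.
by rewrite fB subrr normr0 mulr_ge0 // sqr_ge0.
Qed.

Lemma taylorD (X Y : normedModType R) (A : set X) (f g : X -> Y) :
  taylor_on A f -> taylor_on A g -> taylor_on A (fun x => f x + g x).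
Proof.
move=> [K [D [K0 HD]]] [K' [D' [K'0 HD']]].
exists (K + K'), (fun x v => D x v + D' x v); split; first exact: addr_ge0.
move=> x Ax; have [a b c] := HD _ Ax; have [a' b' c'] := HD' _ Ax; split.
- by move=> k v w; rewrite a a' scalerDr addrACA.
- by move=> v; rewrite (le_trans (ler_normD _ _)) // mulrDl lerD.
- move=> y Ay; rewrite [- (f x + g x)]opprD [- (D x _ + _)]opprD (addrACA (f y)).
  rewrite (addrACA (f y - f x)).
  apply: le_trans (ler_normD _ _) _; rewrite mulrDl.
  by apply: lerD; [exact: c|exact: c'].
Qed.

Lemma taylorM (X : normedModType R) (A : set X) (f g : X -> R) (r : R) :
  A `<=` norm_ball r -> taylor_on A f -> taylor_on A g ->
  taylor_on A (fun x => f x * g x).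
Proof.
move=> Ar tf tg.
have [Lf Lf0 lf] := taylor_lipschitz Ar tf.
have [Lg Lg0 lg] := taylor_lipschitz Ar tg.
have [Bf Bf0 bf] := lipschitz_bounded Ar (taylor_lipschitz Ar tf).
have [Bg Bg0 bg] := lipschitz_bounded Ar (taylor_lipschitz Ar tg).
move: tf tg => [K [D [K0 HD]]] [K' [D' [K'0 HD']]].
exists (Bf * K' + Bg * K + Lf * Lg), (fun x v => f x * D' x v + g x * D x v).
split; first by rewrite !addr_ge0 // mulr_ge0.
move=> x Ax; have [a b c] := HD _ Ax; have [a' b' c'] := HD' _ Ax; split.
- by move=> k v w; rewrite a a' /GRing.scale /=; ring.
- move=> v; rewrite (le_trans (ler_normD _ _)) // !mulrDl.
  apply: ler_wpDr; first by rewrite !mulr_ge0.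
  by rewrite !normrM -!mulrA; apply: lerD; apply: ler_pM; rewrite // ?bf ?bg.
- move=> y Ay.
  rewrite (_ : _ - _ = f x * (g y - g x - D' x (y - x)) +
    g x * (f y - f x - D x (y - x)) + (f y - f x) * (g y - g x)); last by ring.
  apply: le_trans (ler_normD _ _) _; rewrite [leRHS]mulrDl; apply: lerD.
    apply: le_trans (ler_normD _ _) _; rewrite [leRHS]mulrDl !normrM -!mulrA.
    apply: lerD; apply: ler_pM; rewrite // ?bf ?bg //; [exact: c'|exact: c].
  rewrite normrM (_ : _ * _ ^+ 2 = (Lf * `|y - x|) * (Lg * `|y - x|));
    last by ring.
  by apply: ler_pM; rewrite // ?lf ?lg.
Qed.

(** Replacing c y - c x by its linear part inside D' costs only the remainder of
    c, because D' x is linear and bounded. *)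
Lemma taylor_comp (X Y Z : normedModType R) (A : set X) (B : set Y)
    (c : X -> Y) (f : Y -> Z) (r : R) :
  A `<=` norm_ball r -> (forall x, A x -> B (c x)) ->
  taylor_on A c -> taylor_on B f -> taylor_on A (f \o c).
Proof.
move=> Ar AB tc; have [L L0 lc] := taylor_lipschitz Ar tc.
move: tc => [K [D [K0 HD]]] [K' [D' [K'0 HD']]].
exists (K' * K + K' * L ^+ 2), (fun x v => D' (c x) (D x v)).
split; first by rewrite addr_ge0 // mulr_ge0 // sqr_ge0.
move=> x Ax; have [a b e] := HD _ Ax.
have [a' b' e'] := HD' _ (AB _ Ax); split.
- by move=> k v w; rewrite a a'.
- move=> v; rewrite (le_trans (b' _)) // mulrDl -mulrA.
  by apply: ler_wpDr; rewrite ?mulr_ge0 ?sqr_ge0 // ler_wpM2l.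
- move=> y Ay /=.
  have -> : D' (c x) (D x (y - x)) =
    D' (c x) (c y - c x) - D' (c x) (c y - c x - D x (y - x)).
    apply/eqP; rewrite eq_sym subr_eq -[D' _ (D x _)]scale1r -a' scale1r.
    by rewrite (addrC (D x _)) subrK.
  set P := D' (c x) (c y - c x); set Q := D' (c x) (_ - _ - _).
  rewrite [- (P - Q)]opprB addrA addrAC addrC.
  apply: le_trans (ler_normD _ _) _; rewrite [leRHS]mulrDl; apply: lerD.
    by rewrite (le_trans (b' _)) // -mulrA ler_wpM2l // e.
  rewrite (le_trans (e' _ (AB _ Ay))) // -mulrA -exprMn ler_wpM2l //.
  by rewrite lerXn2r ?nnegrE ?mulr_ge0 // lc.
Qed.

Lemma taylor_sum (X Y : normedModType R) (I : Type) (s : seq I) (A : set X)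
    (f : I -> X -> Y) :
  (forall i, taylor_on A (f i)) -> taylor_on A (fun x => \sum_(i <- s) f i x).
Proof.
move=> tf; elim: s => [|i s IH].
  under eq_fun do rewrite big_nil; exact: taylor_cst.
under eq_fun do rewrite big_cons; exact: taylorD.
Qed.

Lemma entry_norm (m n : nat) (M : 'M[R]_(m.+1, n.+1)) i j : `|M i j| <= `|M|.
Proof.
rewrite [leRHS]mx_normrE.
exact: (le_bigmax (0 : R) (fun ij : 'I_m.+1 * 'I_n.+1 => `|M ij.1 ij.2|) (i, j)).
Qed.

Lemma mx_norm_le (m n : nat) (M : 'M[R]_(m.+1, n.+1)) (K : R) :
  (forall i j, `|M i j| <= K) -> `|M| <= K.
Proof.
move=> HK; rewrite [leLHS]mx_normrE; apply: bigmax_le => [|[i j] _]; last exact: HK.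
exact: le_trans (HK 0 0).
Qed.

Lemma taylor_entry (X : normedModType R) (A : set X) (n : nat)
    (f : X -> 'cV[R]_n.+1) (i : 'I_n.+1) (r : R) :
  A `<=` norm_ball r -> taylor_on A f -> taylor_on A (fun x => f x i 0 : R).
Proof.
move=> Ar tf; apply: (@taylor_comp _ _ R A setT f (fun v => v i 0) r) => //.
apply: (@taylor_linear _ R _ _ 1) => [k x y|x]; first by rewrite !mxE.
by rewrite mul1r entry_norm.
Qed.

Lemma taylor_col (X : normedModType R) (A : set X) (n : nat)
    (f : X -> 'cV[R]_n.+1) :
  (forall i, taylor_on A (fun x => f x i 0 : R)) -> taylor_on A f.
Proof.
move=> tf.
have embed_col i : taylor_on A (fun x => f x i 0 *: delta_mx i 0 : 'cV[R]_n.+1).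
  have [K [D [K0 HD]]] := tf i.
  exists K, (fun x v => D x v *: delta_mx i 0); split=> // x /HD[a b c].
  have nd (z : R) : `|z *: delta_mx i 0 : 'cV[R]_n.+1| <= `|z|.
    apply: mx_norm_le => k l; rewrite !mxE normrM ler_piMr //.
    by case: (_ && _); rewrite ?normr1 ?normr0.
  split=> [k v w|v|y Ay]; first by rewrite a scalerDl scalerA.
    by rewrite (le_trans (nd _)).
  by rewrite -!scalerBl (le_trans (nd _)) // c.
have := taylor_sum (index_enum 'I_n.+1) embed_col; congr taylor_on.
apply/funext => x; apply/colP => i.
rewrite summxE (bigD1 i) //= big1 ?addr0 => [|j ji].
  by rewrite !mxE !eqxx mulr1.
by rewrite !mxE eq_sym (negbTE ji) mulr0.
Qed.

End TaylorClass.

(** * Mean value estimates for curves *)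

Section Calculus.
Variable R : realType.

(** The derivative is asked for in the open interval only, with continuity up to
    the end points: this is what the mean value theorem uses, and what a
    one-sided derivative at the end points provides. *)
Definition primitive_on (a b : R) (phi dphi : R -> R) : Prop :=
  {within `[a, b], continuous phi} /\
  forall x : R, x \in `]a, b[%R -> is_derive x 1 phi (dphi x).

Lemma primitive_subitv (a b c d : R) phi dphi : a <= c -> d <= b ->
  primitive_on a b phi dphi -> primitive_on c d phi dphi.
Proof.
move=> ac db [ct dv]; split.
  apply: continuous_subspaceW ct => x /=; rewrite !in_itv /= => /andP[cx xd].
  by rewrite (le_trans ac cx) (le_trans xd db).
move=> x; rewrite in_itv /= => /andP[cx xd]; apply: dv.
by rewrite in_itv /= (le_lt_trans ac cx) (lt_le_trans xd db).
Qed.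

Lemma primitive_global (a b : R) (phi dphi : R -> R) :
  (forall x : R, is_derive x 1 phi (dphi x)) -> primitive_on a b phi dphi.
Proof.
move=> dv; split=> // ; apply: continuous_subspaceT => x.
by apply: differentiable_continuous; apply/derivable1_diffP; have [] := dv x.
Qed.

Lemma primitiveD (a b : R) f df g dg :
  primitive_on a b f df -> primitive_on a b g dg ->
  primitive_on a b (fun x => f x + g x) (fun x => df x + dg x).
Proof.
move=> [cf Df] [cg Dg]; split.
  by move=> x; apply: cvgD; [exact: cf|exact: cg].
by move=> x xab; apply: is_deriveD; [exact: Df|exact: Dg].
Qed.

Lemma primitiveM (a b : R) f df g dg :
  primitive_on a b f df -> primitive_on a b g dg ->
  primitive_on a b (fun x => f x * g x) (fun x => df x * g x + f x * dg x).
Proof.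
move=> [cf Df] [cg Dg]; split.
  by move=> x; apply: cvgM; [exact: cf|exact: cg].
move=> x xab; have df_ := Df _ xab; have dg_ := Dg _ xab.
rewrite addrC [_ * g x]mulrC.
exact: is_deriveM.
Qed.

Lemma primitive_cst (a b c : R) : primitive_on a b (fun=> c) (fun=> 0).
Proof. by apply: primitive_global => x; exact: is_derive_cst. Qed.

Lemma primitive_id (a b : R) : primitive_on a b id (fun=> 1).
Proof. by apply: primitive_global => x; exact: is_derive_id. Qed.

Lemma primitive_sum (a b : R) (I : Type) (s : seq I) (f df : I -> R -> R) :
  (forall i, primitive_on a b (f i) (df i)) ->
  primitive_on a b (fun x => \sum_(i <- s) f i x) (fun x => \sum_(i <- s) df i x).
Proof.
move=> H; elim: s => [|i s IH].
  under eq_fun do rewrite big_nil.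
  under [X in primitive_on _ _ _ X]eq_fun do rewrite big_nil.
  exact: primitive_cst.
under eq_fun do rewrite big_cons.
under [X in primitive_on _ _ _ X]eq_fun do rewrite big_cons.
exact: primitiveD.
Qed.

(** Subtracting the slope [l] in the mean value theorem turns a bound on the
    oscillation of the derivative into a bound on the remainder; the order of
    the remainder depends on how [l] is chosen. *)
Lemma increment_le (a b : R) phi dphi (l K x y : R) :
  primitive_on a b phi dphi -> a <= x -> x <= y -> y <= b ->
  (forall z, x <= z <= y -> `|dphi z - l| <= K) ->
  `|phi y - phi x - l * (y - x)| <= K * (y - x).
Proof.
move=> /primitive_subitv P ax xy yb HK; have [ct dv] := P _ _ ax yb.
have [c] := MVT_segment xy dv ct; rewrite in_itv /= => cxy ->.
rewrite -mulrBl normrM (ger0_norm (_ : 0 <= y - x)) ?subr_ge0 //.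
by rewrite ler_wpM2r ?subr_ge0 ?HK.
Qed.

Lemma increment_approx (a b : R) phi dphi (l K x y : R) :
  primitive_on a b phi dphi -> a <= x <= b -> a <= y <= b ->
  (forall z, a <= z <= b -> `|z - x| <= `|y - x| -> `|dphi z - l| <= K) ->
  `|phi y - phi x - l * (y - x)| <= K * `|y - x|.
Proof.
move=> P /andP[ax xb] /andP[ay yb] HK.
have [xy|/ltW yx] := leP x y.
  rewrite [`|y - x|]ger0_norm ?subr_ge0 //.
  apply: increment_le P _ _ _ _ => // z /andP[xz zy].
  by apply: HK; [lra|rewrite !ger0_norm; lra].
rewrite -normrN opprB (_ : _ - _ = phi x - phi y - l * (x - y)); last by ring.
rewrite [`|y - x|]distrC [`|x - y|]ger0_norm ?subr_ge0 //.
apply: increment_le P _ _ _ _ => // z /andP[yz zx].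
by apply: HK; [lra|rewrite !ler0_norm; lra].
Qed.

Definition curve_primitive (m n : nat) (a b : R)
    (c dc : R -> 'M[R]_(m, n)) : Prop :=
  forall i j, primitive_on a b (fun t => c t i j) (fun t => dc t i j).

Lemma curve_primitiveM (m n p : nat) (a b : R) (f df : R -> 'M[R]_(m, n))
    (g dg : R -> 'M[R]_(n, p)) :
  curve_primitive a b f df -> curve_primitive a b g dg ->
  curve_primitive a b (fun t => f t *m g t) (fun t => df t *m g t + f t *m dg t).
Proof.
move=> Pf Pg i j.
have := primitive_sum (index_enum 'I_n) (fun l => primitiveM (Pf i l) (Pg l j)).
by congr primitive_on; apply/funext => t; rewrite !mxE // -big_split.
Qed.

Lemma curve_primitive_cst (m n : nat) (a b : R) (f : R -> 'M[R]_(m, n)) :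
  a <= b -> curve_primitive a b f (fun=> 0) -> f b = f a.
Proof.
move=> ab P; apply/matrixP => i j; apply/eqP; rewrite -subr_eq0 -normr_le0.
rewrite -[X in `|X|]subr0 -[X in _ - X](mul0r (b - a)) -[leRHS](mul0r (b - a)).
apply: (increment_le (P i j)) => // z _ /=.
by rewrite mxE subrr normr0.
Qed.

Lemma curve_increment (n : nat) (a b : R) (c dc : R -> 'cV[R]_n.+1) l
    (K x y : R) :
  curve_primitive a b c dc -> a <= x <= b -> a <= y <= b ->
  (forall z, a <= z <= b -> `|z - x| <= `|y - x| -> `|dc z - l| <= K) ->
  `|c y - c x - (y - x) *: l| <= K * `|y - x|.
Proof.
move=> P Hx Hy HK; apply: mx_norm_le => i j; rewrite ord1 !mxE [_ * l i 0]mulrC.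
apply: increment_approx (P i 0) Hx Hy _ => z Hz zx.
by have := le_trans (entry_norm (dc z - l) i 0) (HK z Hz zx); rewrite !mxE.
Qed.

Lemma bounded_curve (m n : nat) (a b : R) (c dc : R -> 'M[R]_(m.+1, n.+1)) :
  curve_primitive a b c dc ->
  exists2 r, 0 <= r & forall t, a <= t <= b -> `|c t| <= r.
Proof.
move=> P.
have bd (p : 'I_m.+1 * 'I_n.+1) :
    exists2 r, 0 <= r & forall t, a <= t <= b -> `|c t p.1 p.2| <= r.
  have [ct _] := P p.1 p.2.
  have /ex_strict_bound_gt0[k k0 Hk] :
      bounded_set ((fun t => c t p.1 p.2) @` `[a, b]).
    apply: compact_bounded; apply: continuous_compact => //.
    exact: segment_compact.
  exists k; first exact: ltW.
  by move=> t tab; apply/ltW/Hk; exists t => //=; rewrite in_itv.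
have [k Hk] := choice2 bd.
exists (\sum_p k p); first by apply: sumr_ge0 => p _; case: (Hk p).
move=> t tab; apply: mx_norm_le => i j.
have [k0 /(_ _ tab) H] := Hk (i, j); apply: le_trans H _.
rewrite (bigD1 (i, j)) //= lerDl; apply: sumr_ge0 => l _; by case: (Hk l).
Qed.

(** A solution stays in a ball, where [f] is bounded and Lipschitz; so the curve
    is Lipschitz, its derivative [f \o c] is Lipschitz too, and the mean value
    estimate makes the remainder quadratic. *)
Lemma solution_taylor (n : nat) (T : R) (c : R -> 'cV[R]_n.+1)
    (f : 'cV[R]_n.+1 -> 'cV[R]_n.+1) :
  (forall r, lipschitz_on (norm_ball r) f) ->
  curve_primitive 0 T c (f \o c) ->
  taylor_on `[0, T] c.
Proof.
move=> lf P; have [r r0 Hr] := bounded_curve P.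
have [L L0 HL] := lf r.
have [M M0 HM] : bounded_on (norm_ball r) f.
  exact: (@lipschitz_bounded _ _ _ (norm_ball r) f r).
exists (M + L * M), (fun t v => v *: f (c t)).
split; first by rewrite addr_ge0 ?mulr_ge0.
move=> x /=; rewrite in_itv /= => Hx; split.
- by move=> k v w; rewrite scalerDl scalerA.
- move=> v; rewrite normrZ [leRHS]mulrDl mulrC.
  apply: ler_wpDr; first by rewrite !mulr_ge0.
  by rewrite ler_wpM2r //; exact/HM/Hr.
move=> y; rewrite in_itv /= => Hy.
have lip z : 0 <= z <= T -> `|c z - c x| <= M * `|z - x|.
  move=> Hz; have := curve_increment (l := 0) (K := M) P Hx Hz.
    by rewrite scaler0 subr0; apply=> w Hw _ /=; rewrite subr0; apply/HM/Hr.
rewrite expr2 mulrA; apply: (curve_increment P Hx Hy) => z Hz zx /=.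
apply: le_trans (HL _ _ _ _) _; [exact: Hr|exact: Hr|].
rewrite mulrDl; apply: ler_wpDl; first by rewrite !mulr_ge0.
rewrite -mulrA ler_wpM2l //; apply: le_trans (lip _ Hz) _.
by rewrite ler_wpM2l.
Qed.

(** Both the constant and the linear term of g at t integrate exactly over
    [t - h, t + h], the latter to 0 by symmetry, so only the quadratic remainder
    of g contributes. *)
Lemma midpoint_rule (n : nat) (T : R) (v g : R -> 'cV[R]_n.+1) :
  curve_primitive 0 T v g -> taylor_on `[0, T] g ->
  exists2 K, 0 <= K & forall t h, 0 <= h -> 0 <= t - h -> t + h <= T ->
   `|v (t + h) - v (t - h) - (2 * h) *: g t| <= K * h ^+ 3.
Proof.
move=> P [K [D [K0 HD]]]; exists (K *+ 2); first by rewrite mulrn_wge0.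
move=> t h h0 th hT.
have Ht : 0 <= t <= T by lra.
have [Da Db Dc] := HD t (ltac:(rewrite /= in_itv /= //)).
(* w is v minus the primitive of the linear term of g; it is left with the
   quadratic remainder as derivative, up to the constant g t. *)
pose q : 'cV[R]_n.+1 := - 2^-1 *: D t 1.
pose w s : 'cV[R]_n.+1 := v s + ((s - t) * (s - t)) *: q.
pose dw s : 'cV[R]_n.+1 := g s + (2 * (s - t)) *: q.
have Pw : curve_primitive (t - h) (t + h) w dw.
  move=> i j; apply: primitive_subitv th hT _; rewrite /w /dw.
  have Plin := primitiveD (primitive_id 0 T) (primitive_cst 0 T (- t)).
  have := primitiveD (P i j)
    (primitiveM (primitiveM Plin Plin) (primitive_cst 0 T (q i j))).
  by congr primitive_on; apply/funext => s; rewrite !mxE /=; ring.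
have dwE z : dw z - g t = g z - g t - D t (z - t).
  have -> : D t (z - t) = (z - t) *: D t 1.
    have := Da (z - t) 1 0; rewrite addr0 /GRing.scale /= mulr1 => ->.
    have := Da (-1) 0 0; rewrite scaleN1r oppr0 addr0 => ->.
    by rewrite scaleN1r addNr addr0.
  rewrite /dw /q addrAC; congr (_ + _); rewrite scalerA -scaleNr; congr (_ *: _).
  by field.
have hx : t - h <= t - h <= t + h by lra.
have hy : t - h <= t + h <= t + h by lra.
have := @curve_increment _ _ _ _ _ (g t) (K * h ^+ 2) _ _ Pw hx hy.
have -> : w (t + h) - w (t - h) = v (t + h) - v (t - h).
  rewrite /w opprD addrACA.
  rewrite (_ : (t - h - t) * _ = (t + h - t) * (t + h - t)); last by ring.
  by rewrite subrr addr0.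
rewrite (_ : t + h - (t - h) = 2 * h); last by ring.
rewrite (_ : K *+ 2 * h ^+ 3 = K * h ^+ 2 * `|2 * h|); last first.
  by rewrite ger0_norm ?mulr_ge0 // mulr2n; ring.
apply=> z Hz _; rewrite dwE; apply: le_trans (Dc z _) _.
  by rewrite /= in_itv /=; lra.
rewrite ler_wpM2l // lerXn2r ?nnegrE //.
by rewrite ler_norml; lra.
Qed.

End Calculus.

(** * Continuously differentiable maps on balls *)

Section Multivariate.
Variable R : realType.

Lemma trmx_continuous (m n : nat) :
  continuous (trmx : 'M[R]_(m.+1, n.+1) -> 'M[R]_(n.+1, m.+1)).
Proof.
move=> v B [P Pv PB]; exists (fun i j => P j i) => [i j|w Pw].
  by have := Pv j i; rewrite mxE.
by apply: PB => i j; rewrite mxE; exact: Pw.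
Qed.

(** A box of row vectors is a product of segments, hence compact; transposition
    carries this over to columns. *)
Lemma continuous_bounded_on_ball (n : nat) (Y : normedModType R)
    (f : 'cV[R]_n.+1 -> Y) (r : R) :
  continuous f -> bounded_on (norm_ball r) f.
Proof.
move=> cf.
pose box := [set v : 'rV[R]_n.+1 | forall i, `[- r, r]%classic (v 0 i)].
have cbox : compact box.
  apply: (@rV_compact _ _ (fun=> `[- r, r]%classic)) => _.
  exact: segment_compact.
have cft : continuous (f \o trmx : 'rV[R]_n.+1 -> Y).
  by move=> v; apply: continuous_comp; [exact: trmx_continuous|exact: cf].
have /compact_bounded/ex_strict_bound_gt0[k k0 Hk] : compact ((f \o trmx) @` box).
  by apply: continuous_compact => //; exact: continuous_subspaceT.
exists k; first exact: ltW.
move=> v vr; apply/ltW/Hk; exists v^T; last by rewrite /= trmxK.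
move=> i /=; rewrite in_itv /= -ler_norml mxE.
exact: le_trans (entry_norm v i 0) vr.
Qed.

Lemma segment_primitive (m n : nat) (f : 'cV[R]_m.+1 -> 'cV[R]_n.+1) x v :
  (forall y, differentiable f y) ->
  curve_primitive 0 1 (fun s => f (x + s *: v)) (fun s => 'd f (x + s *: v) v).
Proof.
move=> df i j; rewrite ord1 {j}; apply: primitive_global => s.
have dl : is_diff s (cst x + ( *:%R ^~ v) : R -> 'cV[R]_m.+1) ( *:%R ^~ v).
  by have := is_diffD (is_diff_cst x s) (is_diff_scalel s v); rewrite add0r.
have dfs : differentiable (f \o (cst x + ( *:%R ^~ v))) s.
  by apply: differentiable_comp.
have dg : differentiable ((fun M : 'cV[R]_n.+1 => M i 0) \o
    (f \o (cst x + ( *:%R ^~ v)))) s.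
  by apply: differentiable_comp => //; exact: differentiable_coord.
apply: DeriveDef; first exact: diff_derivable.
have dco M : differentiable (fun M : 'cV[R]_n.+1 => M i 0 : R) M.
  exact: differentiable_coord.
have dls : differentiable (cst x + ( *:%R ^~ v) : R -> 'cV[R]_m.+1) s by [].
have -> : 'D_1 (fun s : R => f (x + s *: v) i 0) s =
    'd (fun M : 'cV[R]_n.+1 => M i 0 : R) (f (x + s *: v))
      ('d f (x + s *: v) v).
  rewrite (deriveE _ dg) (diff_comp dfs (dco _)) /= (diff_comp dls (df _)) /=.
  by rewrite diff_val scale1r.
have cl : linear (fun M : 'cV[R]_n.+1 => M i 0 : R).
  by move=> k M N; rewrite !mxE.
pose c : {linear 'cV[R]_n.+1 -> R} :=
  HB.pack (fun M : 'cV[R]_n.+1 => M i 0 : R) (GRing.isLinear.Build _ _ _ _ _ cl).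
have -> : 'd (fun M : 'cV[R]_n.+1 => M i 0 : R) (f (x + s *: v)) = c :> (_ -> _).
  have H := @diff_lin R _ _ c (f (x + s *: v)) (@coord_continuous R _ _ i 0).
  exact: H.
by [].
Qed.

(** The ball is convex, so the derivative is controlled along the segment. *)
Lemma segment_increment (m n : nat) (f : 'cV[R]_m.+1 -> 'cV[R]_n.+1) x y l K r :
  (forall z, differentiable f z) -> norm_ball r x -> norm_ball r y ->
  (forall z, norm_ball r z -> `|z - x| <= `|y - x| -> `|'d f z (y - x) - l| <= K) ->
  `|f y - f x - l| <= K.
Proof.
move=> df xr yr HK.
have Hx : 0 <= (0 : R) <= 1 by rewrite lexx ler01.
have Hy : 0 <= (1 : R) <= 1 by rewrite lexx ler01.
have := @curve_increment _ _ _ _ _ _ l K 0 1 (segment_primitive x (y - x) df) Hx Hy.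
have -> : x + (1 : R) *: (y - x) = y by rewrite scale1r addrC subrK.
rewrite scale0r addr0 subr0 normr1 mulr1 scale1r.
apply=> s /andP[s0 s1] _; apply: HK.
  rewrite /norm_ball /= (_ : x + _ = (1 - s) *: x + s *: y); last first.
    by rewrite scalerBr scalerBl scale1r addrA addrAC.
  apply: le_trans (ler_normD _ _) _; rewrite !normrZ (ger0_norm s0).
  rewrite ger0_norm ?subr_ge0 // (_ : r = (1 - s) * r + s * r); last by ring.
  by apply: lerD; rewrite ler_wpM2l // subr_ge0.
by rewrite addrAC subrr add0r normrZ (ger0_norm s0) ler_piMl.
Qed.

(** It suffices to bound a linear map on the canonical basis. This is how a
    regularity assumption on x |-> Df(x) v for each fixed v becomes one on
    Df(x) itself. *)
Lemma linear_norm_le (m : nat) (Y : normedModType R) (D : 'cV[R]_m.+1 -> Y)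
    (K : 'I_m.+1 -> R) v :
  linear D -> (forall j, `|D (delta_mx j 0)| <= K j) ->
  `|D v| <= (\sum_j K j) * `|v|.
Proof.
move=> Dl HK.
have D0 : D 0 = 0.
  by have := Dl (-1) 0 0; rewrite scaler0 addr0 scaleN1r addNr.
have DS (I : Type) (s : seq I) (a : I -> R) (w : I -> 'cV[R]_m.+1) :
    D (\sum_(i <- s) a i *: w i) = \sum_(i <- s) a i *: D (w i).
  by elim: s => [|i s IH]; rewrite ?big_nil // !big_cons Dl IH.
rewrite {1}(_ : v = \sum_j v j 0 *: delta_mx j 0); last first.
  rewrite {1}[v]matrix_sum_delta; apply: eq_bigr => j _.
  by rewrite big_ord1.
rewrite DS mulr_suml; apply: le_trans (ler_norm_sum _ _ _) _.
apply: ler_sum => j _; rewrite normrZ mulrC ler_pM // entry_norm //.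
Qed.

Lemma linear_diff (X Y : lmodType R) (D D' : X -> Y) :
  linear D -> linear D' -> linear (fun v => D v - D' v).
Proof. by move=> Dl Dl' k u w; rewrite Dl Dl' scalerBr opprD addrACA. Qed.

Lemma cdiff1_lipschitz (m n : nat) (f : 'cV[R]_m.+1 -> 'cV[R]_n.+1) (r : R) :
  cdiff 1 f -> lipschitz_on (norm_ball r) f.
Proof.
move=> [df cf].
have bd j := continuous_bounded_on_ball r (cf (delta_mx j 0)).
have [K HK] := choice2 bd.
exists (\sum_j K j); first by apply: sumr_ge0 => j _; case: (HK j).
move=> x y xr yr; rewrite -[_ - _]subr0.
apply: (segment_increment df xr yr) => z zr _; rewrite subr0.
apply: linear_norm_le => [k u w|j]; first by rewrite linearP.
by have [_] := HK j; exact.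
Qed.

Lemma cdiff2_cdiff1 (m n : nat) (f : 'cV[R]_m.+1 -> 'cV[R]_n.+1) :
  cdiff 2 f -> cdiff 1 f.
Proof.
move=> [df cf]; split=> // v x; apply: differentiable_continuous.
by have [] := cf v.
Qed.

(** The differential of a C^2 map is C^1 in every direction, hence Lipschitz on
    balls, and the mean value estimate on a segment gives a quadratic
    remainder. *)
Lemma cdiff2_taylor (m n : nat) (f : 'cV[R]_m.+1 -> 'cV[R]_n.+1) (r : R) :
  cdiff 2 f -> taylor_on (norm_ball r) f.
Proof.
move=> cf2; have [df cf] := cf2.
have bd j := continuous_bounded_on_ball r ((cdiff2_cdiff1 cf2).2 (delta_mx j 0)).
have [K HK] := choice2 bd.
have li j := cdiff1_lipschitz r (cf (delta_mx j 0)).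
have [L HL] := choice2 li.
have K0 : 0 <= \sum_j K j by apply: sumr_ge0 => j _; case: (HK j).
have L0 : 0 <= \sum_j L j by apply: sumr_ge0 => j _; case: (HL j).
(* K bounds the differential and L its Lipschitz constant, direction by
   direction. *)
exists (\sum_j K j + \sum_j L j), (fun x v => 'd f x v).
split; first exact: addr_ge0.
move=> x xr; split=> [k u w|v|y yr]; first by rewrite linearP.
  rewrite [leRHS]mulrDl ler_wpDr ?mulr_ge0 //; apply: linear_norm_le => [k u w|j].
    by rewrite linearP.
  by have [_] := HK j; exact.
apply: (segment_increment df xr yr) => z zr zx.
apply: (@le_trans _ _ ((\sum_j L j * `|z - x|) * `|y - x|)).
  apply: (@linear_norm_le _ _ (fun v => 'd f z v - 'd f x v)) => [|j].
    by apply: linear_diff => k u w; rewrite linearP.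
  by have [_] := HL j; exact.
rewrite expr2 mulrA ler_wpM2r // -mulr_suml.
by rewrite mulrDl ler_wpDl ?mulr_ge0 // ler_wpM2l.
Qed.

End Multivariate.

(** * The matrix exponential *)

Lemma mulmx_norm (R : realType) (m n p : nat) (A : 'M[R]_(m.+1, n.+1))
    (B : 'M[R]_(n.+1, p.+1)) : `|A *m B| <= n.+1%:R * `|A| * `|B|.
Proof.
apply: mx_norm_le => i j; rewrite mxE.
apply: le_trans (ler_norm_sum _ _ _) _.
rewrite -mulrA mulr_natl -[X in _ *+ X](card_ord n.+1) -sumr_const.
by apply: ler_sum => l _; rewrite normrM ler_pM // entry_norm.
Qed.

Section MatrixExponential.
Variables (R : realType) (n : nat).
Implicit Types A B : 'M[R]_n.+1.

Lemma mx_cvg (p q : nat) (f : nat -> 'M[R]_(p, q)) (M : 'M[R]_(p, q)) :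
  (forall i j, (fun k => f k i j) @ \oo --> M i j) -> f @ \oo --> M.
Proof.
move=> H B [P PM PB]; rewrite /nbhs /= /nbhs /=.
have : \forall k \near \oo, forall i j, P i j (f k i j).
  apply: filter_forall => i; apply: filter_forall => j.
  exact: (H i j (P i j) (PM i j)).
by apply: filterS => k Hk; exact: PB.
Qed.

Lemma mx_cvg_entry (p q : nat) (f : nat -> 'M[R]_(p, q)) (M : 'M[R]_(p, q)) i j :
  f @ \oo --> M -> (fun k => f k i j) @ \oo --> M i j.
Proof.
move=> fM; apply: (cvg_comp f (fun N : 'M[R]_(p,q) => N i j) fM).
exact: coord_continuous.
Qed.

Lemma seq_cvg_sum (I : Type) (s : seq I) (f : I -> nat -> R) (l : I -> R) :
  (forall i, f i @ \oo --> l i) ->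
  (fun k => \sum_(i <- s) f i k) @ \oo --> \sum_(i <- s) l i.
Proof.
move=> fl; elim: s => [|i s IH].
  under eq_fun do rewrite big_nil.
  by rewrite big_nil; exact: cvg_cst.
under eq_fun do rewrite big_cons.
by rewrite big_cons; exact: cvgD.
Qed.

Lemma mulmx_cvg (f g : nat -> 'M[R]_n.+1) A B :
  f @ \oo --> A -> g @ \oo --> B -> (fun k => f k *m g k) @ \oo --> A *m B.
Proof.
move=> fA gB; apply: mx_cvg => i j; rewrite mxE.
under eq_fun do rewrite mxE.
apply: (@seq_cvg_sum _ _ (fun l k => f k i l * g k l j)
  (fun l => A i l * B l j)) => l.
by apply: cvgM; exact: mx_cvg_entry.
Qed.

Lemma expmx_norm A (k : nat) : `|A ^+ k| <= (n.+1%:R * `|A|) ^+ k.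
Proof.
elim: k => [|k IH].
  rewrite !expr0; apply: mx_norm_le => i j; rewrite mxE.
  by case: (_ == _); rewrite ?normr1 ?normr0 ?ler01.
rewrite !exprSr; apply: le_trans (mulmx_norm _ _) _.
by rewrite mulrAC mulrC ler_wpM2r // mulr_ge0.
Qed.

Definition exp_series A := series (fun k : nat => (k`!%:R : R)^-1 *: A ^+ k).

Lemma exp_series_entry A (x : R) i j :
  (fun k => exp_series (x *: A) k i j) =
  pseries (fun k => (k`!%:R)^-1 * (A ^+ k) i j) x.
Proof.
apply/funext => k; rewrite /exp_series /pseries /series /= summxE.
by apply: eq_bigr => l _; rewrite exprZn !mxE mulrCA mulrC.
Qed.

(** The shift [d] covers the entries of the exponential and those of its first
    two derived series, whose convergence is what termwise differentiation
    requires. *)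
Lemma is_cvg_exp_pseries A (d : nat) (x : R) i j :
  cvgn (pseries (fun k => (k`!%:R)^-1 * (A ^+ (k + d)%N) i j) x).
Proof.
pose a : R := n.+1%:R * `|A|.
have a0 : 0 <= a by rewrite mulr_ge0.
apply: normed_cvg.
apply: (@series_le_cvg _ _ (a ^+ d *: exp_coeff (a * `|x|))) => [k|k|k|].
- exact: normr_ge0.
- by rewrite /GRing.scale /= mulr_ge0 ?exprn_ge0 // exp_coeff_ge0 // mulr_ge0.
- rewrite /= !normrM normrX ger0_norm ?invr_ge0 //.
  have -> : (a ^+ d *: exp_coeff (a * `|x|)) k =
      k`!%:R^-1 * a ^+ (k + d) * `|x| ^+ k.
    have -> : (a ^+ d *: exp_coeff (a * `|x|)) k =
        a ^+ d * ((a * `|x|) ^+ k / k`!%:R) by [].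
    by rewrite exprD [(a * `|x|) ^+ k]exprMn; ring.
  rewrite ler_wpM2r ?exprn_ge0 // ler_wpM2l ?invr_ge0 //.
  exact: le_trans (entry_norm _ _ _) (expmx_norm _ _).
- by apply: is_cvg_seriesZ; exact: is_cvg_series_exp_coeff.
Qed.

Lemma exp_series_cvg A : exp_series A @ \oo --> expm A.
Proof.
have H i j : cvgn (fun k => exp_series A k i j).
  rewrite -[A]scale1r exp_series_entry; have := @is_cvg_exp_pseries A 0 1 i j.
  by under eq_fun do rewrite addn0.
have : exp_series A @ \oo -->
    (\matrix_(i, j) limn (fun k => exp_series A k i j) : 'M[R]_n.+1).
  by apply: mx_cvg => i j; rewrite mxE; exact: H.
by move=> /[dup] /cvgP + _.
Qed.

Lemma expm_commute A B : A *m B = B *m A -> expm A *m B = B *m expm A.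
Proof.
move=> AB.
have cB : (fun _ : nat => B) @ \oo --> B by exact: cvg_cst.
have c1 := mulmx_cvg (@exp_series_cvg A) cB.
have c2 := mulmx_cvg cB (@exp_series_cvg A).
suff E : (fun k => exp_series A k *m B) = (fun k => B *m exp_series A k).
  rewrite E in c1; exact: (cvg_unique _ c1 c2).
apply/funext => k; rewrite /exp_series /series /= mulmx_suml mulmx_sumr.
apply: eq_bigr => l _; rewrite -scalemxAl -scalemxAr; congr (_ *: _).
have BA : GRing.comm B A by exact: esym AB.
by have := commrX l BA.
Qed.

(** Each entry of e^(tA) is a power series in t, which can be differentiated
    term by term. *)
Lemma expm_derive A (x : R) i j :
  is_derive x (1 : R) (fun t => expm (t *: A) i j) ((A *m expm (x *: A)) i j).
Proof.
pose c k : R := (k`!%:R)^-1 * (A ^+ k) i j.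
have cE t : expm (t *: A) i j = limn (pseries c t).
  rewrite -exp_series_entry; apply/esym/cvg_lim => //.
  exact: mx_cvg_entry (@exp_series_cvg _).
have dc (e : nat) : pseries_diffs (fun k => (k`!%:R)^-1 * (A ^+ (k + e)%N) i j) =
    (fun k => (k`!%:R)^-1 * (A ^+ (k + e.+1)%N) i j) :> (nat -> R).
  apply/funext => k; rewrite /pseries_diffs factS natrM invfM -addSnnS.
  by rewrite !mulrA divff ?mul1r // pnatr_eq0.
have c0 : c = (fun k => (k`!%:R)^-1 * (A ^+ (k + 0)%N) i j).
  by apply/funext => k; rewrite addn0.
have D : (A *m expm (x *: A)) i j = limn (pseries (pseries_diffs c) x).
  apply/esym/cvg_lim => //.
  have cA : (fun _ : nat => A) @ \oo --> A by exact: cvg_cst.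
  rewrite (_ : pseries _ x = fun k => (A *m exp_series (x *: A) k) i j).
    exact: mx_cvg_entry (mulmx_cvg cA (@exp_series_cvg (x *: A))).
  apply/funext => k.
  rewrite c0 dc /exp_series /pseries /series /= mulmx_sumr summxE.
  apply: eq_bigr => l _; rewrite addn1 exprZn -!scalemxAr exprS.
  have sc (a : R) (M : 'M[R]_n.+1) : (a *: M) i j = a * M i j by rewrite mxE.
  by rewrite !sc -mulrA; congr (_ * _); rewrite mulrC.
under eq_fun do rewrite cE.
(* Any radius larger than the modulus of x will do. *)
rewrite D; apply: (@pseries_snd_diffs _ c (`|x| + 1)).
- rewrite c0; exact: is_cvg_exp_pseries.
- rewrite c0 dc; exact: is_cvg_exp_pseries.
- rewrite c0 dc dc; exact: is_cvg_exp_pseries.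
- by rewrite [ltRHS]ger0_norm ?addr_ge0 // ltrDl.
Qed.

Lemma expm_primitive (a b : R) A :
  curve_primitive a b (fun t => expm (t *: A)) (fun t => A *m expm (t *: A)).
Proof. by move=> i j; apply: primitive_global => x; exact: expm_derive. Qed.

Lemma expm0 : expm (0 : 'M[R]_n.+1) = 1%:M.
Proof.
apply: (cvg_unique (@norm_hausdorff _ _) (@exp_series_cvg 0)).
apply: cvg_near_cst; exists 1%N => // -[//|k] _.
rewrite /= /exp_series /series /= big_nat_recl // big1 ?addr0 => [|l _].
  by rewrite expr0 fact0 invr1 scale1r.
by rewrite expr0n /= scaler0.
Qed.

(** The derivative of t |-> e^(-t(A+B)) e^(tA) e^(tB) vanishes when A and B
    commute, so the product keeps its value 1 at t = 0. *)
Lemma expm_addN A B : A *m B = B *m A ->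
  expm (- (A + B)) *m (expm A *m expm B) = 1%:M.
Proof.
move=> AB; pose C := - (A + B).
have P := curve_primitiveM (expm_primitive 0 1 C)
  (curve_primitiveM (expm_primitive 0 1 A) (expm_primitive 0 1 B)).
pose F (t : R) := expm (t *: C) *m (expm (t *: A) *m expm (t *: B)).
suff : F 1 = F 0 by rewrite /F !scale1r !scale0r !expm0 !mulmx1.
apply: curve_primitive_cst ler01 _.
move: P; congr curve_primitive; apply/funext => t.
have cA : expm (t *: A) *m B = B *m expm (t *: A).
  by apply: expm_commute; rewrite -scalemxAl AB scalemxAr.
have cC : expm (t *: C) *m C = C *m expm (t *: C).
  by apply: expm_commute; rewrite -scalemxAl scalemxAr.
rewrite -cC -!mulmxA -mulmxDr [expm (t *: A) *m (B *m _)]mulmxA cA.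
rewrite -[B *m expm (t *: A) *m _]mulmxA.
by rewrite -!mulmxDl /C addNr mul0mx mulmx0.
Qed.

Lemma expmVl A : expm (- A) *m expm A = 1%:M.
Proof.
have := @expm_addN A 0; rewrite expm0 mulmx1 addr0; apply.
by rewrite mulmx0 mul0mx.
Qed.

Lemma expmD A B : A *m B = B *m A -> expm (A + B) = expm A *m expm B.
Proof.
move=> /expm_addN E; rewrite -[RHS]mul1mx -(expmVl (- (A + B))) opprK.
by rewrite -mulmxA E mulmx1.
Qed.

Lemma expm_scaleD A (s t : R) :
  expm ((s + t) *: A) = expm (s *: A) *m expm (t *: A).
Proof.
by rewrite scalerDl expmD // -!scalemxAl -!scalemxAr !scalerA mulrC.
Qed.

End MatrixExponential.

(** * Stability of the leapfrog recursion *)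

Section Leapfrog.
Variable R : realType.

(** The geometric majorant a_n = c h^2 r^n with r = 1 + (2K+1)h satisfies
    a_(n+2) = a_(n+1) + 2hK a_(n+1) + h a_(n+1) >= a_n + 2hK a_(n+1) + c h^3.
    The hypothesis that it is at most 1 at the final index keeps the errors in
    the range where the recursion is assumed. *)
Lemma leapfrog_stability (e : nat -> R) (N : nat) (h K c : R) :
  0 <= h -> 0 <= K -> 0 <= c ->
  e 0%N <= 0 -> ((1 <= N)%N -> e 1%N <= c * h ^+ 2) ->
  (forall n, (n.+2 <= N)%N -> e n.+1 <= 1 ->
     e n.+2 <= e n + 2 * h * K * e n.+1 + c * h ^+ 3) ->
  c * h ^+ 2 * (1 + (2 * K + 1) * h) ^+ N <= 1 ->
  forall n, (n <= N)%N -> e n <= c * h ^+ 2 * (1 + (2 * K + 1) * h) ^+ n.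
Proof.
move=> h0 K0 c0 e0 e1 erec small.
set r := 1 + (2 * K + 1) * h in small *.
have r1 : 1 <= r by rewrite lerDl mulr_ge0 // addr_ge0 // mulr_ge0.
have r0 : 0 <= r by apply: le_trans r1.
have ch0 : 0 <= c * h ^+ 2 by rewrite mulr_ge0 // exprn_ge0.
(* A two-step recursion needs two consecutive bounds. *)
suff H n : ((n <= N)%N -> e n <= c * h ^+ 2 * r ^+ n) /\
           ((n.+1 <= N)%N -> e n.+1 <= c * h ^+ 2 * r ^+ n.+1).
  by move=> n; have [] := H n.
elim: n => [|n [IH1 IH2]].
  split=> [_|/e1 H]; first by rewrite (le_trans e0) // mulr_ge0 // exprn_ge0.
  by apply: le_trans H _; rewrite expr1 ler_peMr.
split=> // nN; have {}IH2 := IH2 (ltnW nN).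
have {}IH1 := IH1 (ltnW (ltnW nN)).
have le1 : e n.+1 <= 1.
  apply: le_trans IH2 _; apply: le_trans small.
  by rewrite ler_wpM2l // ler_weXn2l // ltnW.
apply: le_trans (erec _ nN le1) _.
set a := c * h ^+ 2 in IH1 IH2 ch0 *.
have a_le m : a <= a * r ^+ m by rewrite ler_peMr // exprn_ege1.
have -> : c * h ^+ 3 = h * a by rewrite /a; ring.
have E : a * r ^+ n.+2 =
    a * r ^+ n.+1 + 2 * h * K * (a * r ^+ n.+1) + h * (a * r ^+ n.+1).
  by rewrite (exprS r n.+1) {1}/r; ring.
rewrite E; apply: lerD; last by rewrite ler_wpM2l.
apply: lerD; last by rewrite ler_wpM2l // !mulr_ge0.
apply: le_trans IH1 _; rewrite ler_wpM2l // ler_weXn2l //.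
Qed.

Variable d : nat.
Implicit Types (L : 'M[R]_d.+1) (F : 'cV[R]_d.+1 -> 'cV[R]_d.+1).

Fixpoint exp_leapfrog L F (u0 : 'cV[R]_d.+1) (h : R) (n : nat) : 'cV[R]_d.+1 :=
  match n with
  | 0%N => u0
  | n1.+1 =>
    match n1 with
    | 0%N => expm (h *: L) *m u0 + h *: (expm (h *: L) *m F u0)
    | n2.+1 => expm ((2 * h) *: L) *m exp_leapfrog L F u0 h n2
               + (2 * h) *: (expm (h *: L) *m F (exp_leapfrog L F u0 h n1))
    end
  end.

(** The vector field seen in the rotating variable e^(-tL) u. *)
Definition interaction_field L F (t : R) (b : 'cV[R]_d.+1) : 'cV[R]_d.+1 :=
  expm (- t *: L) *m F (expm (t *: L) *m b).

Lemma expmNK L (t : R) (b : 'cV[R]_d.+1) :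
  expm (t *: L) *m (expm (- t *: L) *m b) = b.
Proof. by rewrite mulmxA -expm_scaleD subrr scale0r expm0 mul1mx. Qed.

Lemma expm_step L (s t r : R) (b : 'cV[R]_d.+1) : s + t = r ->
  expm (s *: L) *m (expm (t *: L) *m b) = expm (r *: L) *m b.
Proof. by move=> <-; rewrite mulmxA -expm_scaleD. Qed.

(** In the rotating variable the two exponentials e^(2hL) and e^(hL) of the
    scheme cancel by the group law, and the leapfrog rule remains. *)
Lemma exp_leapfrogSS L F u0 h n :
  let w n := expm (- (n%:R * h) *: L) *m exp_leapfrog L F u0 h n in
  w n.+2 = w n + (2 * h) *: interaction_field L F (n.+1%:R * h) (w n.+1).
Proof.
move=> w; rewrite /interaction_field /w expmNK.
set U := exp_leapfrog L F u0 h.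
have -> : U n.+2 = expm ((2 * h) *: L) *m U n +
    (2 * h) *: (expm (h *: L) *m F (U n.+1)) by [].
rewrite mulmxDr -scalemxAr; congr (_ + _ *: _); apply: expm_step.
  by rewrite -[n.+2]addn2 natrD; ring.
by rewrite -[in LHS]addn1 natrD; ring.
Qed.

Lemma exp_leapfrog1 L F u0 h :
  expm (- (1%:R * h) *: L) *m exp_leapfrog L F u0 h 1 = u0 + h *: F u0.
Proof.
rewrite /= mulmxDr -scalemxAr mul1r !(@expm_step _ _ _ 0) ?addNr //.
by rewrite scale0r expm0 !mul1mx.
Qed.

End Leapfrog.

(** * Convergence of the exponential integrator *)

Lemma natM_le (R : realType) (h T : R) (k l : nat) :
  0 <= h -> (k <= l)%N -> l%:R * h <= T -> k%:R * h <= T.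
Proof. by move=> h0 kl; apply: le_trans; rewrite ler_wpM2r // ler_nat. Qed.

Section Convergence.
Variables (R : realType) (d : nat).
Variables (L : 'M[R]_d.+1) (F : 'cV[R]_d.+1 -> 'cV[R]_d.+1).
Hypothesis F_taylor : forall r, taylor_on (norm_ball r) F.

Lemma F_lipschitz r : lipschitz_on (norm_ball r) F.
Proof. by apply: (@taylor_lipschitz _ _ _ _ F r) => //; exact: F_taylor. Qed.

Lemma F_bounded r : bounded_on (norm_ball r) F.
Proof. by apply: (@lipschitz_bounded _ _ _ _ F r) => //; exact: F_lipschitz. Qed.

Lemma mulmx_lipschitz (A : 'M[R]_d.+1) (D : set 'cV[R]_d.+1) :
  lipschitz_on D (fun v => A *m v).
Proof.
exists (d.+1%:R * `|A|); first by rewrite mulr_ge0.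
by move=> x y _ _; rewrite -mulmxBr mulmx_norm.
Qed.

Lemma expm_bounded (A : 'M[R]_d.+1) (T : R) :
  exists2 m, 0 <= m & forall t (b : 'cV[R]_d.+1), 0 <= t <= T ->
    `|expm (t *: A) *m b| <= m * `|b|.
Proof.
have [m m0 Hm] := bounded_curve (expm_primitive 0 T A).
exists (d.+1%:R * m); first by rewrite mulr_ge0.
move=> t b Ht; apply: le_trans (mulmx_norm _ _) _.
by rewrite ler_wpM2r // ler_wpM2l // Hm.
Qed.

(** Every column of e^(tA) solves the linear equation c' = A c. *)
Lemma expm_entry_taylor (A : 'M[R]_d.+1) (T : R) i j :
  taylor_on `[0, T] (fun t => expm (t *: A) i j : R).
Proof.
have P : curve_primitive 0 T (fun t => col j (expm (t *: A)))
    (fun t => A *m col j (expm (t *: A))).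
  move=> k l; have := expm_primitive 0 T A k j.
  congr primitive_on; apply/funext => t; rewrite !mxE //.
  by apply: eq_bigr => q _; rewrite mxE.
have := taylor_entry i (@itv_ball _ T) (solution_taylor
  (f := fun v => A *m v) (fun r => mulmx_lipschitz A (norm_ball r)) P).
by congr taylor_on; apply/funext => t; rewrite mxE.
Qed.

Variables (T : R) (u : R -> 'cV[R]_d.+1).
Hypothesis T0 : 0 < T.
Hypothesis u_sol : curve_primitive 0 T u (fun t => L *m u t + F (u t)).

Let v t := expm (- t *: L) *m u t.
Let g t := expm (- t *: L) *m F (u t).

(** The terms -L and L cancel because e^(-tL) commutes with L. *)
Lemma exact_primitive : curve_primitive 0 T v g.
Proof.
have := curve_primitiveM (expm_primitive 0 T (- L)) u_sol.
have -> : (fun t => expm (t *: - L) *m u t) = v.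
  by apply/funext => t; rewrite scalerN -scaleNr.
congr (curve_primitive _ _ _ _); apply/funext => t; rewrite scalerN -scaleNr.
have -> : - L *m expm (- t *: L) = - (expm (- t *: L) *m L).
  rewrite mulNmx; congr (- _); apply/esym/expm_commute.
  by rewrite -scalemxAl scalemxAr.
by rewrite mulmxDr mulNmx mulmxA addKr.
Qed.

Lemma exact_field_taylor : taylor_on `[0, T] g.
Proof.
have [r r0 Hr] := bounded_curve u_sol.
have ut : taylor_on `[0, T] u.
  apply: solution_taylor (fun v => L *m v + F v) _ u_sol => r'.
  by apply: lipschitzD; [exact: mulmx_lipschitz|exact: F_lipschitz].
have Fut : taylor_on `[0, T] (F \o u).
  apply: taylor_comp (@itv_ball _ T) _ ut (F_taylor r) => t.
  by rewrite /= in_itv /=; exact: Hr.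
apply: taylor_col => i.
have H l : taylor_on `[0, T] (fun t => expm (t *: (- L)) i l * F (u t) l 0).
  apply: (taylorM (@itv_ball _ T)); first exact: expm_entry_taylor.
  exact: (taylor_entry l (@itv_ball _ T) Fut).
have := taylor_sum (index_enum _) H.
congr taylor_on; apply/funext => t; rewrite /g mxE.
by apply: eq_bigr => l _; rewrite scalerN scaleNr.
Qed.

(** Euler's rule needs only that g is Lipschitz. Its defect is one order larger
    than that of the midpoint rule, but it is used for a single step. *)
Lemma exact_step_defects : exists2 c, 0 <= c &
  (forall h, 0 <= h <= T -> `|v h - v 0 - h *: g 0| <= c * h ^+ 2) /\
  (forall t h, 0 <= h -> 0 <= t - h -> t + h <= T ->
    `|v (t + h) - v (t - h) - (2 * h) *: g t| <= c * h ^+ 3).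
Proof.
have [K K0 HK] := midpoint_rule exact_primitive exact_field_taylor.
have [M M0 HM] := taylor_lipschitz (@itv_ball _ T) exact_field_taylor.
exists (M + K); first exact: addr_ge0.
split=> [h /andP[h0 hT]|t h h0 th hT]; last first.
  by apply: le_trans (HK _ _ h0 th hT) _; rewrite ler_wpM2r ?exprn_ge0 // lerDr.
have H0 : 0 <= (0 : R) <= T by rewrite lexx ltW.
have Hh : 0 <= h <= T by rewrite h0.
have := curve_increment (l := g 0) (K := M * h) exact_primitive H0 Hh.
rewrite subr0 (ger0_norm h0) => H; apply: le_trans (H _) _ => [z Hz zh|].
  apply: le_trans (HM 0 z _ _) _; rewrite /= ?in_itv //=.
  by rewrite ler_wpM2l //; rewrite !subr0 in zh *.
by rewrite -mulrA -expr2 ler_wpM2r ?exprn_ge0 // lerDl.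
Qed.

(** For t between 0 and T, e^(tL) is bounded, so a point at distance at most 1 from
    the exact solution is mapped into one fixed ball, on which F is
    Lipschitz. *)
Lemma interaction_field_lipschitz : exists2 K, 0 <= K & forall t b, 0 <= t <= T ->
  `|b - v t| <= 1 -> `|interaction_field L F t b - g t| <= K * `|b - v t|.
Proof.
have [r r0 Hr] := bounded_curve u_sol.
have [m m0 Hm] := expm_bounded L T.
have [m' m'0 Hm'] := expm_bounded (- L) T.
have [K K0 HK] := F_lipschitz (r + m).
(* r bounds the exact solution, and m the effect of e^(tL) on a perturbation of
   size 1. *)
exists (m' * (K * m)); first by rewrite !mulr_ge0.
move=> t b Ht b1.
have ub : expm (t *: L) *m b - u t = expm (t *: L) *m (b - v t).
  by rewrite mulmxBr /v expmNK.
have ubn : `|expm (t *: L) *m b - u t| <= m * `|b - v t| by rewrite ub Hm.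
rewrite /interaction_field /g -mulmxBr scaleNr -scalerN.
apply: le_trans (Hm' _ _ Ht) _; rewrite -mulrA ler_wpM2l //.
have ur : norm_ball (r + m) (u t).
  by rewrite /norm_ball /=; apply: le_trans (Hr _ Ht) _; rewrite lerDl.
have br : norm_ball (r + m) (expm (t *: L) *m b).
  rewrite /norm_ball /= -[_ *m b](subrK (u t)).
  apply: le_trans (ler_normD _ _) _; rewrite addrC; apply: lerD; first exact: Hr.
  by apply: le_trans ubn _; rewrite ler_piMr.
apply: le_trans (HK _ _ ur br) _.
by rewrite -mulrA ler_wpM2l.
Qed.

(** For each fixed number of steps the iterate is bounded uniformly in the step
    size. The bound may grow arbitrarily fast with [n]; it serves for step sizes
    bounded away from 0, for which only finitely many [n] occur. *)
Lemma exp_leapfrog_bounded (n : nat) : exists2 b, 0 <= b &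
  forall h, 0 <= h <= 1 -> n%:R * h <= T -> `|exp_leapfrog L F (u 0) h n| <= b.
Proof.
have [m m0 Hm] := expm_bounded L T.
suff H k : (exists2 b, 0 <= b & forall h, 0 <= h <= 1 -> k%:R * h <= T ->
              `|exp_leapfrog L F (u 0) h k| <= b) /\
           (exists2 b, 0 <= b & forall h, 0 <= h <= 1 -> k.+1%:R * h <= T ->
              `|exp_leapfrog L F (u 0) h k.+1| <= b) by have [] := H n.
elim: k => [|k [[b0 b00 H0] IH]].
  split; first by exists `|u 0|.
  exists (m * `|u 0| + m * `|F (u 0)|); first by rewrite addr_ge0 // mulr_ge0.
  move=> h /andP[h0 h1]; rewrite mul1r => hT.
  have Hh : 0 <= h <= T by rewrite h0.
  apply: le_trans (ler_normD _ _) _; apply: lerD; first exact: Hm.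
  rewrite normrZ ger0_norm //; apply: le_trans (Hm _ (F (u 0)) Hh).
  by rewrite ler_piMl.
split=> //; have [b1 b10 H1] := IH.
have [M M0 HM] := F_bounded b1.
exists (m * b0 + 2 * (m * M)); first by rewrite addr_ge0 // !mulr_ge0.
move=> h /andP[h0 h1] hT.
have hk2 : 2 * h <= T.
  exact: (@natM_le _ _ _ 2 _ h0 _ hT).
have -> : exp_leapfrog L F (u 0) h k.+2 =
    expm ((2 * h) *: L) *m exp_leapfrog L F (u 0) h k
    + (2 * h) *: (expm (h *: L) *m F (exp_leapfrog L F (u 0) h k.+1)) by [].
apply: le_trans (ler_normD _ _) _; apply: lerD.
  apply: le_trans (Hm _ _ _) _; first by rewrite hk2 mulr_ge0.
  by rewrite ler_wpM2l // H0 ?h0 // (natM_le h0 _ hT) // -addn2 leq_addr.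
rewrite normrZ ger0_norm ?mulr_ge0 // ler_pM ?mulr_ge0 //.
  by rewrite ler_piMr.
apply: le_trans (Hm _ _ _) _.
  by rewrite h0 /=; apply: le_trans hk2; rewrite mulr2n mulrDl mul1r lerDl.
rewrite ler_wpM2l //; apply: HM; apply: H1; first by rewrite h0.
exact: natM_le hT.
Qed.

(** The alternative c E h^2 <= 1 decides whether the majorant of the errors is
    below 1, as stability requires. If it fails, then 1 < c E h, so that
    n < c E (n h) <= c E T is bounded, and 1 < c E h^2 lets the factor h^2
    absorb any constant. *)
Theorem exp_leapfrog_convergence : exists C : R, forall h, 0 < h <= 1 ->
  forall n : nat, n%:R * h <= T ->
    `|u (n%:R * h) - exp_leapfrog L F (u 0) h n| <= C * h ^+ 2.
Proof.
have [r r0 Hr] := bounded_curve u_sol.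
have [m m0 Hm] := expm_bounded L T.
have [c c0 [euler midpoint]] := exact_step_defects.
have [K K0 HK] := interaction_field_lipschitz.
have [b Hb] := choice2 exp_leapfrog_bounded.
pose E := expR ((2 * K + 1) * T).
have E0 : 0 <= c * E by rewrite mulr_ge0 // expR_ge0.
(* N bounds the number of steps when the step size is not small, and S the
   corresponding errors. *)
pose N := Num.bound (c * E * T).
pose S := \sum_(i < N) (r + b i).
have rb0 i : 0 <= r + b i by rewrite addr_ge0 //; case: (Hb i).
have S0 : 0 <= S by exact: sumr_ge0.
exists (m * (c * E) + S * (c * E)) => h /andP[h0 h1] n nh; have h0' := ltW h0.
have h2 : 0 <= h ^+ 2 by rewrite exprn_ge0.
have nh0 (k : nat) : 0 <= k%:R * h by rewrite mulr_ge0.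
have [small|large] := leP (c * E * h ^+ 2) 1; last first.
  have nN : (n < N)%N.
    rewrite -(ltr_nat R); apply: le_lt_trans (archi_boundP _); last first.
      by rewrite mulr_ge0 // ltW.
    apply: le_trans (_ : c * E * (n%:R * h) <= _); last by rewrite ler_wpM2l.
    rewrite mulrCA ler_peMr //; apply: le_trans (ltW large) _.
    by rewrite ler_wpM2l // expr2 ler_piMl.
  apply: (@le_trans _ _ S).
    rewrite /S (bigD1 (Ordinal nN)) //=.
    apply: ler_wpDr; first exact: sumr_ge0.
    apply: le_trans (ler_normB _ _) _; apply: lerD; first by rewrite Hr // nh0.
    by have [_] := Hb n; apply => //; rewrite h0'.
  rewrite [leRHS]mulrDl; apply: ler_wpDl; first by rewrite !mulr_ge0 ?expR_ge0.
  by rewrite -[S * _ * _]mulrA ler_peMr // ltW.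
pose w k := expm (- (k%:R * h) *: L) *m exp_leapfrog L F (u 0) h k.
pose e k := `|w k - v (k%:R * h)|.
have v0 : v 0 = u 0 by rewrite /v oppr0 scale0r expm0 mul1mx.
have g0 : g 0 = F (u 0) by rewrite /g oppr0 scale0r expm0 mul1mx.
have rho k : (k <= n)%N -> (1 + (2 * K + 1) * h) ^+ k <= E.
  move=> kn; apply: (@le_trans _ _ (expR ((2 * K + 1) * h) ^+ k)).
    rewrite lerXn2r ?nnegrE ?expR_ge0 ?expR_ge1Dx // addr_ge0 // mulr_ge0 //.
    by rewrite addr_ge0 // mulr_ge0.
  rewrite -expRM_natl ler_expR mulrCA ler_wpM2l ?addr_ge0 ?mulr_ge0 //.
  by apply: le_trans nh; rewrite ler_wpM2r // ler_nat.
have en : e n <= c * h ^+ 2 * (1 + (2 * K + 1) * h) ^+ n.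
  apply: (@leapfrog_stability _ e n h K c) => //.
  - by rewrite /e /w mul0r v0 oppr0 scale0r expm0 mul1mx subrr normr0.
  - move=> n1; rewrite /e distrC /w exp_leapfrog1 opprD addrA mul1r -g0 -v0.
    rewrite euler // h0' /=; apply: le_trans nh.
    by rewrite ler_peMl // ler1n.
  - move=> k kn e1; have kT : k.+2%:R * h <= T.
      exact: natM_le nh.
    set t := k.+1%:R * h.
    have th1 : t + h = k.+2%:R * h by rewrite /t -[k.+2]addn1 natrD; ring.
    have th2 : t - h = k%:R * h by rewrite /t -[k.+1]addn1 natrD; ring.
    have Ht : 0 <= t <= T.
      by rewrite nh0 /=; exact: natM_le kT.
    have HM := midpoint t h h0'; rewrite th1 th2 in HM.
    have {}HM := HM (nh0 _) kT.
    rewrite /e /w exp_leapfrogSS -/(w k) -/(w k.+1) -/t.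
    set fw := interaction_field _ _ _ _.
    rewrite (_ : _ - _ = (w k - v (k%:R * h)) + (2 * h) *: (fw - g t) -
       (v (k.+2%:R * h) - v (k%:R * h) - (2 * h) *: g t)); last first.
      by apply/colP => i; rewrite !mxE; ring.
    apply: le_trans (ler_normB _ _) _; apply: lerD => //.
    apply: le_trans (ler_normD _ _) _; apply: lerD => //.
    rewrite normrZ ger0_norm ?mulr_ge0 // -mulrA ler_wpM2l ?mulr_ge0 //.
    exact: HK.
  - apply: le_trans small; rewrite [leRHS]mulrAC ler_wpM2l ?mulr_ge0 //.
    exact: rho.
have -> : u (n%:R * h) - exp_leapfrog L F (u 0) h n =
    - (expm ((n%:R * h) *: L) *m (w n - v (n%:R * h))).
  by rewrite mulmxBr /w /v !expmNK opprB.
rewrite normrN; apply: le_trans (Hm _ _ _) _; first by rewrite nh0.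
rewrite [leRHS]mulrDl; apply: ler_wpDr; first by rewrite !mulr_ge0 ?expR_ge0.
rewrite -[m * _ * _]mulrA ler_wpM2l //.
apply: le_trans en _; rewrite [leRHS]mulrAC ler_wpM2l ?mulr_ge0 //.
exact: rho.
Qed.

End Convergence.

(** * One-sided derivatives and complex limits *)

Section DifferenceQuotient.
Variable R : realType.

(** At an interior point the limit within [0, T] is an ordinary derivative; at an
    end point it still forces continuity. *)
Lemma difference_quotient_primitive (T : R) (f df : R -> R) :
  (forall t, 0 <= t <= T ->
    ((s - t)^-1 * (f s - f t)) @[s --> within `[0, T] t^'] --> df t) ->
  primitive_on 0 T f df.
Proof.
move=> H.
have Hd t e : 0 <= t <= T -> 0 < e ->
    exists2 r, 0 < r & forall s, 0 <= s <= T -> s != t ->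
      `|t - s| < r -> `|df t - (s - t)^-1 * (f s - f t)| <= e.
  move=> Ht e0; have /cvgrPdist_le /(_ e e0) := H t Ht.
  move=> [r /= r0 Hr]; exists r => // s Hs st ts.
  by apply: (Hr s) => //=; rewrite in_itv.
split.
  apply/subspace_continuousP => t; rewrite /= in_itv /= => Ht.
  have [r r0 Hr] := Hd t 1 Ht ltr01.
  apply/cvgrPdist_le => e e0.
  pose K := `|df t| + 1.
  have K0 : 0 < K by rewrite ltr_wpDl.
  (* Within distance r of t the difference quotients are bounded by K. *)
  exists (Num.min r (e / K)) => /=; first by rewrite lt_min r0 divr_gt0.
  move=> s /= ; rewrite lt_min => /andP[sr se]; rewrite in_itv /= => Hs.
  have [->|st] := eqVneq s t; first by rewrite subrr normr0 ltW.
  have /(_ s Hs st sr) q := Hr.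
  have qK : `|(s - t)^-1 * (f s - f t)| <= K.
    rewrite -[X in `|X|](subrK (df t)) (le_trans (ler_normD _ _)) // addrC /K.
    by rewrite lerD2l distrC.
  have -> : f t - f s = (t - s) * ((s - t)^-1 * (f s - f t)).
    by field; rewrite subr_eq0.
  rewrite normrM; apply: (@le_trans _ _ (e / K * K)).
    by rewrite ler_pM // ltW.
  by rewrite divfK // gt_eqF.
move=> t; rewrite in_itv /= => /andP[t0 tT].
have Ht : 0 <= t <= T by rewrite !ltW.
have C : h^-1 *: (f (h *: (1:R) + t) - f t) @[h --> 0^'] --> df t.
  apply/cvgrPdist_le => e e0; have [r r0 Hr] := Hd t e Ht e0.
  exists (Num.min r (Num.min t (T - t))) => /=.
    by rewrite !lt_min r0 t0 subr_gt0.
  move=> h /=; rewrite sub0r normrN !lt_min => /andP[hr /andP[ht hT]] h0.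
  have := Hr (h + t); rewrite addrK [_ *: 1]mulr1; apply.
  - by move: ht hT; rewrite !ltr_norml; lra.
  - by rewrite -subr_eq0 addrK.
  - by rewrite opprD addrCA subrr addr0 normrN.
apply: DeriveDef; first by apply/cvg_ex; exists (df t).
exact: cvg_lim C.
Qed.

Lemma normc_lt_parts (z : R[i]) (e : R) : `|z| < (e%:C)%C ->
  `|complex.Re z| < e /\ `|complex.Im z| < e.
Proof.
case: z => a b; rewrite normc_def ltcR => H.
have e0 : 0 <= e by apply: ltW; apply: le_lt_trans H; exact: sqrtr_ge0.
split; apply: le_lt_trans H => /=; rewrite -sqrtr_sqr ler_wsqrtr //.
  by rewrite lerDl sqr_ge0.
by rewrite lerDr sqr_ge0.
Qed.

(** Real and imaginary parts are bounded by the modulus. *)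
Lemma cvg_complex_parts (n : nat) (S : Type) (G : set_system S)
    (f : S -> 'cV[R[i]]_n) (l : 'cV[R[i]]_n) (k : 'I_n) : Filter G -> f @ G --> l ->
  (complex.Re (f s k 0) @[s --> G] --> complex.Re (l k 0)) /\
  (complex.Im (f s k 0) @[s --> G] --> complex.Im (l k 0)).
Proof.
move=> FG fl.
have H (e : R) : 0 < e -> \forall s \near G, `|l k 0 - f s k 0| < (e%:C)%C.
  move=> e0; apply: (fl [set M | `|l k 0 - M k 0| < (e%:C)%C]).
  exists (fun i j => [set z | `|l i j - z| < (e%:C)%C]) => [i j|M HM]; last first.
    exact: HM.
  have := @nbhsx_ballx _ R[i] (l i j) (e%:C)%C; rewrite ltcR => /(_ e0).
  by [].
split; apply/cvgrPdist_lt => e /H; apply: filterS => s /normc_lt_parts [].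
  by case: (l k 0) (f s k 0) => [a b] [a' b'].
by case: (l k 0) (f s k 0) => [a b] [a' b'] /=.
Qed.

End DifferenceQuotient.

(** * Real coordinates on the state space *)

Section Embedding.
Local Open Scope complex_scope.
Variable R : realType.

Definition timelike (k : 'I_8) : bool := (k %% 4 == 3)%N.

(** The real coordinates of the state space: the components t and w are i times
    their coordinate. *)
Definition embed (a : 'cV[R]_8) : 'cV[R[i]]_8 :=
  \col_k (if timelike k then 0 +i* a k 0 else (a k 0)%:C).

Definition coords (U : 'cV[R[i]]_8) : 'cV[R]_8 :=
  \col_k (if timelike k then complex.Im (U k 0) else complex.Re (U k 0)).

Lemma coordsK U : state_space U -> embed (coords U) = U.
Proof.
move=> HU; apply/colP => k; rewrite !mxE; have := HU k; rewrite -/(timelike k).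
by case: (timelike k); case: (U k 0) => a b /= ->.
Qed.

Lemma embedK a : coords (embed a) = a.
Proof. by apply/colP => k; rewrite !mxE; case: (timelike k). Qed.

Lemma embedD a b : embed (a + b) = embed a + embed b.
Proof.
apply/colP => k; rewrite !mxE; case: (timelike k).
  by apply/eqP; rewrite eq_complex /= addr0 !eqxx.
by apply/eqP; rewrite eq_complex /= addr0 !eqxx.
Qed.

Lemma embedZ (r : R) a : embed (r *: a) = r%:C *: embed a.
Proof.
apply/colP => k; rewrite !mxE; case: (timelike k);
  by apply/eqP; rewrite eq_complex /=; apply/andP; split; apply/eqP; ring.
Qed.

Lemma embedB a b : embed (a - b) = embed a - embed b.
Proof.
rewrite embedD -scaleN1r embedZ; congr (_ + _).
rewrite -[RHS]scaleN1r; congr (_ *: _); apply/eqP.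
by rewrite eq_complex /= oppr0 !eqxx.
Qed.

Lemma coordsB U V : coords (U - V) = coords U - coords V.
Proof.
apply/colP => k; rewrite !mxE.
by case: (timelike k); case: (U k 0); case: (V k 0).
Qed.

Lemma coordsZ (r : R) U : coords (r%:C *: U) = r *: coords U.
Proof.
apply/colP => k; rewrite !mxE.
by case: (timelike k); case: (U k 0) => a b /=; ring.
Qed.

(** Matrices that do not couple the real components with the imaginary ones.
    They act on R^8 and on the state space by the same entries. *)
Definition preserves_timelike (A : 'M[R]_8) : Prop :=
  forall k l, timelike k != timelike l -> A k l = 0.

Lemma embed_mulmx (A : 'M[R]_8) a : preserves_timelike A ->
  complex_mx A *m embed a = embed (A *m a).
Proof.
move=> HA; apply/colP => k; rewrite !mxE.
transitivity (\sum_l embed (A k l * a l 0 *: delta_mx k 0) k 0).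
  apply: eq_bigr => l _; rewrite !mxE !eqxx mulr1.
  have [kl|/HA ->] := eqVneq (timelike k) (timelike l).
    rewrite -kl; case: (timelike k);
    by apply/eqP; rewrite eq_complex /=; apply/andP; split; apply/eqP; ring.
  by case: (timelike k); case: (timelike l); apply/eqP; rewrite eq_complex /=;
    apply/andP; split; apply/eqP; ring.
have E (s : seq 'I_8) :
    \sum_(l <- s) embed (A k l * a l 0 *: delta_mx k 0) k 0 =
    (if timelike k then 0 +i* (\sum_(l <- s) A k l * a l 0)
     else (\sum_(l <- s) A k l * a l 0)%:C).
  elim: s => [|l s IH]; first by rewrite !big_nil; case: (timelike k).
  rewrite !big_cons IH !mxE !eqxx mulr1; case: (timelike k).
    by apply/eqP; rewrite eq_complex /= addr0 !eqxx.
  by apply/eqP; rewrite eq_complex /= addr0 !eqxx.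
exact: E.
Qed.

(** Not coupling the two kinds of components means commuting with the projection
    on one of them, and this passes to the exponential. *)
Lemma preserves_timelike_expm (A : 'M[R]_8) :
  preserves_timelike A -> preserves_timelike (expm A).
Proof.
move=> HA.
pose P : 'M[R]_8 := diag_mx (\row_k (timelike k)%:R).
have AP : A *m P = P *m A.
  apply/matrixP => k l; rewrite mul_mx_diag mul_diag_mx !mxE.
  have [<-|/HA ->] := eqVneq (timelike k) (timelike l); first by rewrite mulrC.
  by rewrite mulr0 mul0r.
move=> k l kl; have /matrixP/(_ k l) := expm_commute AP.
rewrite mul_mx_diag mul_diag_mx !mxE; move: kl.
by case: (timelike k); case: (timelike l) => // _;
  rewrite !(mul0r, mulr0, mul1r, mulr1).
Qed.

Lemma preserves_timelikeZ (r : R) A :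
  preserves_timelike A -> preserves_timelike (r *: A).
Proof. by move=> HA k l kl; rewrite mxE HA // mulr0. Qed.

(** The norm of R^8 is the maximum norm; 8 is a crude bound for sqrt 8. *)
Lemma euclid_embed a : euclid_norm (embed a) <= 8%:R * `|a|.
Proof.
rewrite /euclid_norm (eq_bigr (fun k => a k 0 ^+ 2)); last first.
  move=> k _; rewrite mxE /ComplexField.Normc.normc.
  by case: (timelike k); rewrite /= expr0n /= ?add0r ?addr0 sqrtr_sqr
    real_normK // num_real.
rewrite -[leRHS]ger0_norm ?mulr_ge0 // -sqrtr_sqr ler_wsqrtr //.
apply: (@le_trans _ _ (\sum_(k < 8) `|a| ^+ 2)).
  apply: ler_sum => k _; rewrite -[a k 0 ^+ 2]real_normK ?num_real //.
  by rewrite lerXn2r ?nnegrE // entry_norm.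
rewrite sumr_const card_ord exprMn -[_ *+ 8]mulr_natl ler_wpM2r ?exprn_ge0 //.
by rewrite -natrX ler_nat.
Qed.

End Embedding.

(** * The charged-particle system in real coordinates *)

Section Fields.
Local Open Scope complex_scope.
Variables (R : realType) (B E : 'cV[R]_3 -> 'cV[R]_3).

Lemma Lmx_preserves_timelike x0 : preserves_timelike (Lmx B x0).
Proof.
move=> k l; rewrite /Lmx.
case: (@split_ordP 4 4 k) => i ->; case: (@split_ordP 4 4 l) => j -> kl.
- by apply: etrans (block_mxEul _ _ _ _ _ _) _; rewrite mxE.
- apply: etrans (block_mxEur _ _ _ _ _ _) _; rewrite mxE; move: kl.
  rewrite /timelike /= modnDl.
  by case: (eqVneq i j) => // ->; rewrite eqxx.
- by apply: etrans (block_mxEdl _ _ _ _ _ _) _; rewrite mxE.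
- apply: etrans (block_mxEdr _ _ _ _ _ _) _; rewrite mxE; move: kl.
  rewrite /timelike /= !modnDl.
  by case: i => [[|[|[|[|//]]]] ?]; case: j => [[|[|[|[|//]]]] ?].
Qed.

Definition real_position (a : 'cV[R]_8) : 'cV[R]_3 := \col_(k < 3) a (inord k) 0.

Lemma position_embed a : position (embed a) = real_position a.
Proof.
apply/colP => k; rewrite !mxE /timelike inordK; last first.
  by apply: leq_trans (ltn_ord k) _.
by case: k => [[|[|[|//]]] ?].
Qed.

(** With w = i omega the terms -i w E and i E . v become omega E and, for
    omega', E . v: hence a symmetric matrix without signs. *)
Definition real_Emx (x : 'cV[R]_3) : 'M[R]_4 :=
  let e (k : 'I_3) := E x k 0 in
  mx4 [:: [:: 0;   0;   0;   e 0];
          [:: 0;   0;   0;   e 1];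
          [:: 0;   0;   0;   e 2];
          [:: e 0; e 1; e 2; 0]].

Definition real_Gmx (x0 x : 'cV[R]_3) : 'M[R]_4 :=
  Bhat B x - Bhat B x0 + real_Emx x.

Definition real_F (x0 : 'cV[R]_3) (a : 'cV[R]_8) : 'cV[R]_8 :=
  (col_mx 0 (real_Gmx x0 (real_position a) *m
     dsubmx (a : 'cV[R]_(4 + 4))) : 'cV[R]_(4 + 4)).

Lemma col8_u (K : Type) (A D : 'cV[K]_4) i :
  (col_mx A D : 'cV[K]_8) (@lshift 4 4 i) 0 = A i 0.
Proof. exact: col_mxEu. Qed.

Lemma col8_d (K : Type) (A D : 'cV[K]_4) i :
  (col_mx A D : 'cV[K]_8) (@rshift 4 4 i) 0 = D i 0.
Proof. exact: col_mxEd. Qed.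

Lemma F_embed x0 a : Ffun B E x0 (embed a) = embed (real_F x0 a).
Proof.
rewrite /Ffun position_embed; set x := real_position a.
apply/colP => k; rewrite [RHS]mxE /real_F -/x.
case: (@split_ordP 4 4 k) => i ->.
  by rewrite !col8_u !mxE; case: (timelike _).
rewrite !col8_d /timelike /= modnDl.
rewrite mxE [in RHS]mxE.
rewrite !big_ord_recl !big_ord0.
by case: i => [[|[|[|[|//]]]] ?] /=; rewrite !mxE /timelike /=;
  apply/eqP; rewrite eq_complex /=; apply/andP; split; apply/eqP; ring.
Qed.

(** The components are polynomial in the velocity and in the C^2 fields taken at
    the position, so the closure properties of [taylor_on] apply. *)
Lemma real_F_taylor x0 r : cdiff 2 B -> cdiff 2 E ->
  taylor_on (norm_ball r) (real_F x0).
Proof.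
move=> HB HE.
have ball_sub (X : normedModType R) :
  (norm_ball r : set X) `<=` norm_ball r by [].
have field_taylor (C : 'cV[R]_3 -> 'cV[R]_3) i : cdiff 2 C ->
    taylor_on (norm_ball r) (fun x => C x i 0 : R).
  by move=> /cdiff2_taylor HC; exact: taylor_entry (HC r).
have opp_taylor (f : 'cV[R]_3 -> R) : taylor_on (norm_ball r) f ->
    taylor_on (norm_ball r) (fun x => - f x : R).
  move=> tf; have := taylorM (ball_sub _) (taylor_cst _ (-1 : R)) tf.
  by congr taylor_on; apply/funext => x; rewrite mulN1r.
have G_taylor i j : taylor_on (norm_ball r) (fun x => real_Gmx x0 x i j : R).
  have : taylor_on (norm_ball r)
      (fun x => Bhat B x i j + (- Bhat B x0 i j) + real_Emx x i j : R).
    apply: taylorD; [apply: taylorD; last exact: taylor_cst|].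
      case: i => [[|[|[|[|//]]]] ?]; case: j => [[|[|[|[|//]]]] ?];
      under eq_fun do rewrite mxE /=;
      first [exact: taylor_cst | exact: field_taylor
            | by apply: opp_taylor; exact: field_taylor].
    case: i => [[|[|[|[|//]]]] ?]; case: j => [[|[|[|[|//]]]] ?];
    under eq_fun do rewrite mxE /=;
    first [exact: taylor_cst | exact: field_taylor].
  by congr taylor_on; apply/funext => x; rewrite !mxE.
have pos_le a : `|real_position a| <= 1 * `|a|.
  by rewrite mul1r; apply: mx_norm_le => i j; rewrite mxE entry_norm.
have pos_taylor : taylor_on (norm_ball r) real_position.
  apply: (@taylor_linear _ _ _ _ _ 1) => // k a b.
  by apply/colP => i; rewrite !mxE.
apply: taylor_col => k; case: (@split_ordP 4 4 k) => i ->.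
  under eq_fun do rewrite col8_u mxE.
  exact: taylor_cst.
under eq_fun do rewrite col8_d mxE.
apply: taylor_sum => j; apply: (@taylorM _ _ _ _ _ r) => //.
  apply: (taylor_comp (ball_sub _) _ pos_taylor (G_taylor i j)) => a ar.
  by apply: le_trans (pos_le a) _; rewrite mul1r.
apply: (@taylor_linear _ _ _ _ _ 1) => [c a b|a]; rewrite !mxE //.
by rewrite mul1r entry_norm.
Qed.

(** A step is built from F, e^(hL) and e^(2hL) by real linear combinations, and
    none of these leaves the state space. *)
Lemma num_solution_embed U0 h n : state_space U0 ->
  let x0 := position U0 in
  num_solution B E U0 h n =
  embed (exp_leapfrog (Lmx B x0) (real_F x0) (coords U0) h n).
Proof.
move=> /coordsK HU0 x0.
have step s a : complex_mx (expm (s *: Lmx B x0)) *m embed a =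
    embed (expm (s *: Lmx B x0) *m a).
  apply: embed_mulmx; apply/preserves_timelike_expm/preserves_timelikeZ.
  exact: Lmx_preserves_timelike.
suff H k : num_solution B E U0 h k =
      embed (exp_leapfrog (Lmx B x0) (real_F x0) (coords U0) h k) /\
    num_solution B E U0 h k.+1 =
      embed (exp_leapfrog (Lmx B x0) (real_F x0) (coords U0) h k.+1).
  by have [] := H n.
elim: k => [|k [IH1 IH2]].
  split; first by rewrite /= HU0.
  by rewrite /= embedD embedZ -!step -F_embed HU0.
split=> //.
have -> : num_solution B E U0 h k.+2 =
    complex_mx (expm ((2 * h) *: Lmx B x0)) *m num_solution B E U0 h k
    + (2 * h)%:C *: (complex_mx (expm (h *: Lmx B x0)) *m
        Ffun B E x0 (num_solution B E U0 h k.+1)) by [].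
by rewrite IH1 IH2 F_embed !step -embedZ -embedD.
Qed.

Lemma coords_solution T U0 U : is_exact_solution B E T U0 U ->
  let x0 := position U0 in
  curve_primitive 0 T (fun t => coords (U t))
    (fun t => Lmx B x0 *m coords (U t) + real_F x0 (coords (U t))).
Proof.
move=> [_ HU] x0 k j; rewrite ord1 {j}.
apply: difference_quotient_primitive => t Ht.
have [HX HV] := HU t Ht.
have UE : U t = embed (coords (U t)) by rewrite coordsK.
have [re im] := cvg_complex_parts k _ HV.
have cE (W : 'cV[R[i]]_8) : coords W k 0 =
    if timelike k then complex.Im (W k 0) else complex.Re (W k 0) by rewrite mxE.
have qE s : (s - t)^-1 * (coords (U s) k 0 - coords (U t) k 0) =
    coords ((s - t)^-1%:C *: (U s - U t)) k 0.
  by rewrite coordsZ coordsB !mxE.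
rewrite /=; under eq_fun do rewrite qE cE.
have -> : Lmx B x0 *m coords (U t) + real_F x0 (coords (U t)) =
    coords (complex_mx (Lmx B x0) *m U t + Ffun B E x0 (U t)).
  rewrite [in RHS]UE embed_mulmx; last exact: Lmx_preserves_timelike.
  by rewrite F_embed -embedD embedK.
by rewrite cE; case: (timelike k).
Qed.

End Fields.

Theorem theorem2p2 (R : realType) (B E : 'cV[R]_3 -> 'cV[R]_3)
    (HB : cdiff 2 B) (HE : cdiff 2 E)
    (T : R) (HT : 0 < T)
    (U0 : 'cV[R[i]]_8) (HU0 : state_space U0)
    (U : R -> 'cV[R[i]]_8) (HU : is_exact_solution B E T U0 U) :
  exists C : R, forall h : R, 0 < h <= 1 ->
    forall n : nat, n%:R <= T / h ->
      euclid_norm (U (n%:R * h) - num_solution B E U0 h n) <= C * h ^+ 2.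
Proof.
have F_taylor r := @real_F_taylor _ B E (position U0) r HB HE.
have [C HC] := exp_leapfrog_convergence F_taylor HT (coords_solution HU).
exists (8%:R * C) => h /[dup] Hh /andP[h0 h1] n; rewrite ler_pdivlMr // => nT.
have [U00 /(_ (n%:R * h)) [|HX _]] := HU; first by rewrite nT mulr_ge0 // ltW.
rewrite -(coordsK HX) num_solution_embed // -embedB.
apply: le_trans (euclid_embed _) _; rewrite -mulrA ler_wpM2l //.
by have := HC h Hh n nT; rewrite /= U00.
Qed.
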